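(* Assume that either (i) $\omega_b\subset\omega$ and $\omega_b$ satisfies the Geometric Control Condition (GCC), or (ii) $0\le b(x)\le b_+$ for all $x\in\Omega$ with $b_+\in(0,b^*]$, there is $b_->0$ with $b>b_-$ a.e. in $\omega_b$, and both $\omega_b$ and $\omega$ satisfy the Piecewise Multipliers Geometric Condition (PMGC). Assume moreover that $f_1,f_2$ satisfy Hypothesis (N) of the context (with Lipschitz function $L$), and that $$e^{\alpha\tau}\|a_2\|_{L^\infty(\Omega)}<\frac{\alpha}{M},$$ where $M>0$ and $\alpha>0$ are constants with $\|S(t)\|_{\mathcal L(\mathcal H)}\le Me^{-\alpha t}$ for all $t\ge 0$. Let $T>0$ and let $U\in C([0,T);\mathcal H)$ be a solution of the delayed problem $$\dot U(t)=\mathcal A U(t)-\mathcal B U(t-\tau)+\mathcal F(U(t)),\ t>0,\qquad U(0)=U_0,\qquad \mathcal B U(s)=\Psi(s),\ s\in[-\tau,0],$$ satisfying $\|U(t)\|_{\mathcal H}\le C_\rho$ for all $t\in[0,T)$, where $C_\rho>0$ is a constant such that $$L(C_\rho)<\frac{\alpha-M\|a_2\|_{L^\infty(\Omega)}e^{\alpha\tau}}{M}.$$ Then for every $t\in[0,T)$ $$\|U(t)\|_{\mathcal H}\le M\left(\|U_0\|_{\mathcal H}+\int_0^\tau e^{\alpha s}\|\Psi(s-\tau)\|_{\mathcal H}\,ds\right)e^{-\left(\alpha-M\|a_2\|_{L^\infty(\Omega)}e^{\alpha\tau}-ML(C_\rho)\right)t}.$$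
   Context: **Setting.** $\Omega\subset\mathbb R^n$ is a bounded open domain with boundary of class $C^2$; $\tau>0$ is a constant delay; $a_1,b\in C^0(\overline\Omega,\mathbb R)$, $a_2\in L^\infty(\Omega)$ (real valued, no sign condition); $a_1\ge 0$ a.e. in $\Omega$ and $a_1>a_0>0$ a.e. in a given open subset $\omega\subset\Omega$, for some constant $a_0$; $\omega_b$ is a non-empty open set with $\overline{\omega_b}\subset\{x\in\Omega: b(x)\ne 0\}$. The system considered is $$u_{tt}-\Delta u+b\,y_t+a_1u_t=f_1(u),\qquad y_{tt}-\Delta y-b\,u_t+a_2\,y_t(\cdot,t-\tau)=f_2(y)\quad\text{in }\Omega\times(0,\infty),$$ with $u=y=0$ on $\partial\Omega\times(0,\infty)$, $u(0)=u_0$, $u_t(0)=u_1$, $y(0)=y_0$, $y_t(0)=y_1$, and $y_t=g$ on $\Omega\times[-\tau,0]$. **Abstract form.** $\mathcal H=(H_0^1(\Omega)\times L^2(\Omega))^2$ with norm $\|(u_1,u_2,y_1,y_2)\|_{\mathcal H}^2=\|\nabla u_1\|_{L^2}^2+\|u_2\|_{L^2}^2+\|\nabla y_1\|_{L^2}^2+\|y_2\|_{L^2}^2$. With $U=(u,u_t,y,y_t)$, $U_0=(u_0,u_1,y_0,y_1)\in\mathcal H$: $\mathcal A(u_1,u_2,y_1,y_2)=(u_2,\ \Delta u_1-by_2-a_1u_2,\ y_2,\ \Delta y_1+bu_2)$ with domain $D(\mathcal A)=((H^2(\Omega)\cap H_0^1(\Omega))\times H_0^1(\Omega))^2$; $\mathcal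 B(u_1,u_2,y_1,y_2)=(0,0,0,a_2y_2)$; $\mathcal F(u_1,u_2,y_1,y_2)=(0,f_1(u_1),0,f_2(y_1))$; $\Psi(s)=(0,0,0,a_2g(s))$, with $\Psi\in C([-\tau,0];\mathcal H)$. $\mathcal A$ generates a contraction semigroup $(S(t))_{t\ge0}$ on $\mathcal H$. A solution is a mild solution, i.e. a continuous $\mathcal H$-valued function satisfying $$U(t)=S(t)U_0-\int_0^tS(t-s)\mathcal BU(s-\tau)\,ds+\int_0^tS(t-s)\mathcal F(U(s))\,ds,$$ where $\mathcal BU(s-\tau)$ is understood as $\Psi(s-\tau)$ when $s-\tau<0$. **Geometric assumptions.** A subset $\omega\subset\Omega$ satisfies the Geometric Control Condition (GCC) if there is $T>0$ such that every ray of geometrical optics starting at any point $x\in\Omega$ at $t=0$ enters $\omega$ within time $T$. A subset $\omega\subset\Omega$ satisfies the Piecewise Multipliers Geometric Condition (PMGC) if there exist subsets $\Omega_j\subset\Omega$ with Lipschitz boundaries and points $x_j\in\mathbb R^n$, $j=1,\dots,J$, such that $\Omega_i\cap\Omega_j=\emptyset$ for $i\neq j$ and $\omega$ contains a neighborhood in $\Omega$ of $\bigcup_{j}\gamma_j(x_j)\cup(\Omega\setminus\bigcup_j\Omega_j)$, where $\gamma_j(x_j)=\{x\in\partial\Omega_j:(x-x_j)\cdot\nu_j(x)\ge0\}$ and $\nu_j$ is the outward unit normal to $\partial\Omega_j$. (G1): $\omega_b\subset\omega$ and $\omega_b$ satisfies the GCC. (G2): $0\le b(x)\le b_+$ for all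 $x\in\Omega$ with $b_+\in(0,b^*]$, there is $b_->0$ with $b>b_-$ a.e. in $\omega_b$, and both $\omega_b$ and $\omega$ satisfy the PMGC. Here $b^*>0$ is a constant depending on the domain and the control region, namely the threshold in the known result of Alabau-Boussouira, Wang and Yu giving exponential stability of $S(t)$. It is known that under (G1) or (G2) there exist $M,\alpha>0$ with $\|S(t)\|_{\mathcal L(\mathcal H)}\le Me^{-\alpha t}$ for all $t\ge0$; $M,\alpha$ denote such constants. **Hypothesis (N).** $f_1,f_2:\mathbb R\to\mathbb R$ are continuous and: (1) $f_1(0)=f_2(0)=0$; (2) for every $r>0$ there is $L(r)>0$ such that for $i=1,2$, $\|f_i(u)-f_i(v)\|_{L^2(\Omega)}\le L(r)\|\nabla u-\nabla v\|_{L^2(\Omega)}$ for all $u,v\in H_0^1(\Omega)$ with $\|\nabla u\|_{L^2}\le r$, $\|\nabla v\|_{L^2}\le r$, and $L(r)\to0$ as $r\to0$; (3) there are strictly increasing continuous $h_1,h_2:\mathbb R_+\to\mathbb R_+$ with $h_i(0)=0$ and $\left|\int_\Omega f_i(u)u\,dx\right|\le h_i(\|\nabla u\|_{L^2})\|\nabla u\|_{L^2}^2$ for all $u\in H_0^1(\Omega)$, $i=1,2$. *)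

(* Defs.v *)
From HB Require Import structures.
From mathcomp Require Import all_boot all_order all_algebra.
From mathcomp Require Import all_classical all_reals all_analysis.
Set Implicit Arguments.
Unset Strict Implicit.
Unset Printing Implicit Defensive.
Import Order.TTheory GRing.Theory Num.Theory.
Import numFieldNormedType.Exports.
Local Open Scope classical_set_scope.
Local Open Scope ring_scope.

(* Lebesgue measure on R^d, d = n.+1 >= 1: infimum of the total volume over
   countable covers by open boxes, restricted to its Caratheodory sigma-algebra. *)
Section lebesgue_rV.
Variables (R : realType) (n : nat).
Local Notation V := 'rV[R]_n.+1.

Definition box (c : V * V) : set V :=
  [set x | forall i, c.1 0 i < x 0 i /\ x 0 i < c.2 0 i].

Definition box_vol (c : V * V) : \bar R :=
  (\prod_(i < n.+1) Num.max 0 (c.2 0 i - c.1 0 i))%:E.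

Definition box_cover (A : set V) : set (nat -> V * V) :=
  [set c | A `<=` \bigcup_k box (c k)].

Definition leb_outer (A : set V) : \bar R :=
  ereal_inf [set (\sum_(k <oo) box_vol (c k))%E | c in box_cover A].

Local Open Scope ereal_scope.

Lemma box_vol_ge0 c : 0 <= box_vol c.
Proof. by rewrite lee_fin; apply: prodr_ge0 => i _; rewrite le_max lexx. Qed.

Lemma leb_outer_ge0 A : 0 <= leb_outer A.
Proof.
apply: le_ereal_inf_tmp => _ [c _ <-].
by apply: nneseries_ge0 => k _ _; exact: box_vol_ge0.
Qed.

Lemma leb_outer0 : leb_outer set0 = 0.
Proof.
apply/eqP; rewrite eq_le leb_outer_ge0 andbT.
apply: ereal_inf_lbound; exists (fun=> (0%R, 0%R)) => //.
apply: eseries0 => k _ _; rewrite /box_vol big_ord_recl /=.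
by rewrite subrr maxxx mul0r.
Qed.

Lemma le_leb_outer : {homo leb_outer : A B / A `<=` B >-> A <= B}.
Proof.
move=> A B AB; apply/ereal_inf_le_tmp => _ [c Bc <-].
by exists c => //; exact: subset_trans AB Bc.
Qed.

Lemma leb_outer_sigma_subadditive : sigma_subadditive leb_outer.
Proof.
move=> A; have [[i ioo]|] := pselect (exists i, leb_outer (A i) = +oo).
  rewrite (eseries_pinfty _ _ ioo) ?leey// => k _.
  by rewrite -ltNye (lt_le_trans _ (leb_outer_ge0 _)).
rewrite -forallNE => Aoo.
apply/lee_addgt0Pr => _/posnumP[e].
rewrite (le_trans _ (epsilon_trick _ _ _))//; last first.
  by move=> k; exact: leb_outer_ge0.
pose P k (c : nat -> V * V) := box_cover (A k) c /\
  \sum_(j <oo) box_vol (c j) <= leb_outer (A k) + (e%:num / (2 ^ k.+1)%:R)%:E.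
have [G PG] : {G : nat -> nat -> V * V & forall k, P k (G k)}.
  apply: (@choice _ _ P) => k; rewrite /P /leb_outer.
  set S := (X in ereal_inf X); move infS : (ereal_inf S) => iS.
  case: iS infS => [r Sr|Soo|Soo].
  - have en1 : (0 < e%:num / (2 ^ k.+1)%:R)%R by [].
    have /(lb_ereal_inf_adherent en1) : ereal_inf S \is a fin_num by rewrite Sr.
    move=> [x [c Akc xc] xS].
    by exists c; split => //; rewrite xc -Sr; exact/ltW.
  - by have := Aoo k; rewrite /leb_outer Soo.
  - by have := leb_outer_ge0 (A k); rewrite /leb_outer Soo.
pose vG := fun p : nat * nat => box_vol (G p.1 p.2).
have vG_ge0 p : 0 <= vG p by exact: box_vol_ge0.
apply: (@le_trans _ _ (\esum_(p in setT) vG p)).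
  have /card_esym/ppcard_eqP[f] := card_nat2.
  apply: ereal_inf_lbound => /=.
  exists (fun k => G (f k).1 (f k).2).
    move=> t [i _] /(PG i).1[j _ Gt].
    by exists (f^-1%FUN (i, j)) => //=; rewrite invK ?inE.
  rewrite -(esum_pred_image vG f xpredT) ?[fun=> _]set_true//.
  by rewrite image_eq.
rewrite (_ : esum _ _ = \sum_(i <oo) \sum_(j <oo) box_vol (G i j)); last first.
  pose J : nat -> set (nat * nat) := fun i => [set (i, j) | j in setT].
  rewrite (_ : setT = \bigcup_k J k); last first.
    by rewrite predeqE => -[a b]; split => // _; exists a => //; exists b.
  rewrite esum_bigcupT /=; last 2 first.
    - apply/trivIsetP => i j _ _ ij.
      rewrite predeqE => -[k m] /=; split => //= -[] [_] _ [<-{k} _].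
      by move=> [m' _] [] /esym/eqP; rewrite (negbTE ij).
    - by [].
  rewrite -(image_id [set: nat]) -fun_true esum_pred_image//; last first.
    by move=> k _; exact: esum_ge0.
  apply: eq_eseriesr => /= j _.
  rewrite -(esum_pred_image vG (pair j) predT)//=; last first.
    by move=> ? ? _ _; exact: (@can_inj _ _ _ snd).
  by congr esum; rewrite predeqE => -[a b]; split; move=> [i _ <-]; exists i.
apply: lee_lim.
- apply: is_cvg_nneseries => k *.
  by apply: nneseries_ge0 => m *; exact: box_vol_ge0.
- by apply: is_cvg_nneseries => k *; apply: adde_ge0 => //; exact: leb_outer_ge0.
- by near=> k; apply: lee_sum => i _; exact: (PG i).2.
Unshelve. all: by end_near. Qed.

HB.instance Definition _ := isOuterMeasure.Build R V leb_outer
  leb_outer0 leb_outer_ge0 le_leb_outer leb_outer_sigma_subadditive.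

HB.instance Definition _ := Measurable.copy V (caratheodory_type leb_outer).

Definition leb : set V -> \bar R := leb_outer.

HB.instance Definition _ := isMeasure.Build _ V R leb
  (leb_outer0 : leb set0 = 0) leb_outer_ge0
  (@caratheodory_measure_sigma_additive _ _ leb_outer).
End lebesgue_rV.
Arguments leb R n A : clear implicits.

Section euclidean.
Variables (R : realType) (n : nat).
Local Notation V := 'rV[R]_n.+1.

(* The library norm on row vectors is the sup norm: it gives the right topology,
   but metric notions have to use enorm. *)
Definition dotp (x y : V) : R := \sum_i x 0 i * y 0 i.
Definition enorm (x : V) : R := Num.sqrt (dotp x x).

Definition boundary (A : set V) : set V := closure A `\` A°.

Definition partial (i : 'I_n.+1) (f : V -> R) (x : V) : R :=
  'D_(delta_mx 0 i) f x.

Definition grad (f : V -> R) (x : V) : V := \row_i partial i f x.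

(* f is of class C^k on the open set A *)
Fixpoint class_C (k : nat) (A : set V) (f : V -> R) : Prop :=
  (forall x, A x -> {for x, continuous f}) /\
  if k is k'.+1 then
    forall i, (forall x, A x -> derivable f x (delta_mx 0 i)) /\
              class_C k' A (partial i f)
  else True.

(* phi is a C^2 defining function of Omega near x *)
Definition C2_defining (Omega : set V) (x : V) (phi : V -> R) : Prop :=
  exists N : set V, [/\ open N, N x, class_C 2 N phi,
    (forall y, N y -> grad phi y != 0) &
    (forall y, N y -> (Omega y <-> phi y < 0))].

Definition C2_boundary (Omega : set V) : Prop :=
  forall x, boundary Omega x -> exists phi, C2_defining Omega x phi.

(* Near each boundary point, O is the strict hypograph, in some unit direction e,
   of a Lipschitz function of the component orthogonal to e. *)
Definition lipschitz_boundary (O : set V) : Prop :=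
  forall x0, boundary O x0 ->
  exists (e : V) (r K : R) (f : V -> R),
    [/\ enorm e = 1, 0 < r,
        (forall x y, `|f x - f y| <= K * enorm (x - y)) &
        (forall x, enorm (x - x0) < r ->
           (O x <-> dotp x e < f (x - dotp x e *: e)))].

(* The boundary of O is differentiable at x, with outward unit normal nu.  For a
   Lipschitz boundary such a nu exists almost everywhere, for a C^2 boundary
   everywhere; it is unique. *)
Definition outward_normal (O : set V) (x nu : V) : Prop :=
  [/\ boundary O x, enorm nu = 1 &
      forall eps, 0 < eps -> exists2 r, 0 < r &
        forall y, enorm (y - x) < r ->
          (dotp (y - x) nu < - (eps * enorm (y - x)) -> O y) /\
          (eps * enorm (y - x) < dotp (y - x) nu -> ~ O y)].

(* Acceleration of a ray at x with velocity v.  It vanishes in the interior and at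
   diffractive points, where the free ray moves strictly into Omega to second
   order; at the other glancing points the ray glides, with the acceleration that
   keeps it in the boundary. *)
Definition ray_acceleration (Omega : set V) (x v a : V) : Prop :=
  (Omega x -> a = 0) /\
  (boundary Omega x -> exists phi, [/\ C2_defining Omega x phi,
     dotp v (grad phi x) = 0 &
     a = - (Num.max 0 ('D_v ('D_v phi) x) / dotp (grad phi x) (grad phi x))
         *: grad phi x]).

(* Rays of geometrical optics for the wave operator d_t^2 - Delta in Omega, i.e.
   the generalized bicharacteristics of Melrose and Sjostrand (Hoermander, The
   Analysis of Linear Partial Differential Operators III, Definition 24.3.7), in
   unit-speed parametrization: g is the position, v the velocity, B the discrete
   set of times of specular reflection. *)
Definition is_ray (Omega : set V) (g v : R -> V) (B : set R) : Prop :=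
  [/\ {within `[0, +oo[, continuous g},
      (forall t, 0 <= t -> closure Omega (g t)),
      B `<=` `]0, +oo[,
      (forall t, B t -> boundary Omega (g t) /\
        exists r, [/\ 0 < r, r <= t,
          (forall s, 0 < `|s - t| < r -> ~ B s /\ Omega (g s)) &
          exists nu v1 v2, [/\ outward_normal Omega (g t) nu,
            v @ t^'- --> v1, v @ t^'+ --> v2, dotp v1 nu != 0 &
            v2 = v1 - (2 * dotp v1 nu) *: nu]]) &
      (forall t, 0 <= t -> ~ B t ->
        enorm (v t) = 1 /\
        exists a, [/\ ray_acceleration Omega (g t) (v t) a,
          (s - t)^-1 *: (g s - g t)
            @[s --> within [set s | 0 <= s /\ ~ B s] t^'] --> v t &
          (s - t)^-1 *: (v s - v t)
            @[s --> within [set s | 0 <= s /\ ~ B s] t^'] --> a])].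

Definition GCC (Omega omega : set V) : Prop :=
  exists2 T, 0 < T & forall x g v B, Omega x -> is_ray Omega g v B -> g 0 = x ->
    exists t, 0 <= t <= T /\ omega (g t).

Definition multiplier_boundary (O : set V) (c : V) : set V :=
  [set x | exists nu, outward_normal O x nu /\ 0 <= dotp (x - c) nu].

Definition PMGC (Omega omega : set V) : Prop :=
  exists (J : nat) (O : 'I_J -> set V) (c : 'I_J -> V),
    [/\ (forall j, O j `<=` Omega), (forall j, lipschitz_boundary (O j)),
        (forall i j, i != j -> O i `&` O j = set0) &
        exists N : set V, [/\ open N,
          \bigcup_j multiplier_boundary (O j) (c j) `<=` N,
          Omega `\` \bigcup_j O j `<=` N &
          N `&` Omega `<=` omega]].

End euclidean.

Section function_spaces.
Variables (R : realType) (n : nat) (Omega : set 'rV[R]_n.+1).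
Local Notation V := 'rV[R]_n.+1.
Local Notation mu := (leb R n).

(* Elements of L^p(Omega) are represented by functions on R^d, of which only the
   restriction to Omega matters. *)
Definition Lp (p : \bar R) (u : V -> R) : Prop := (u \_ Omega) \in Lfun mu p.
Definition Lp_norm (p : \bar R) (u : V -> R) : \bar R :=
  'N[mu]_p[EFin \o (u \_ Omega)]%E.

Definition ae_on (u v : V -> R) : Prop := u = v %[ae mu in Omega].

Definition test_function (phi : V -> R) : Prop :=
  let supp := closure [set x | phi x != 0] in
  [/\ forall k, class_C k setT phi, compact supp & supp `<=` Omega].

(* An element of H^1 is represented by the pair of the function and its weak
   gradient; the latter is determined (a.e. in Omega) by the former. *)
Definition H1pair : Type := ((V -> R) * (V -> V))%type.

(* H^1_0: closure of the test functions in H^1 *)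
Definition H10 (u : H1pair) : Prop :=
  [/\ Lp 2%:E u.1, (forall i, Lp 2%:E (fun x => u.2 x 0 i)) &
      forall eps : R, 0 < eps -> exists phi, [/\ test_function phi,
        (Lp_norm 2%:E (phi - u.1)%R < eps%:E)%E &
        (Lp_norm 2%:E (fun x => enorm (grad phi x - u.2 x)%R) < eps%:E)%E]].

Definition grad_norm (u : H1pair) : R := fine (Lp_norm 2%:E (@enorm R n \o u.2)).

Definition weak_partial (j : 'I_n.+1) (u w : V -> R) : Prop :=
  forall phi, test_function phi ->
    \int[mu]_(x in Omega) (u x * partial j phi x) =
    - \int[mu]_(x in Omega) (w x * phi x).

(* u (a function of H^1) is in H^2, and w is its Laplacian *)
Definition H2_laplacian (u : H1pair) (w : V -> R) : Prop :=
  exists h : 'I_n.+1 -> 'I_n.+1 -> V -> R,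
    (forall i j, Lp 2%:E (h i j) /\ weak_partial j (fun x => u.2 x 0 i) (h i j)) /\
    ae_on w (fun x => \sum_i h i i x).

(* ((u1, u2), (y1, y2)) *)
Definition state : Type := ((H1pair * (V -> R)) * (H1pair * (V -> R)))%type.

Definition Hspace (x : state) : Prop :=
  [/\ H10 x.1.1, Lp 2%:E x.1.2, H10 x.2.1 & Lp 2%:E x.2.2].

Definition Hnorm (x : state) : R :=
  Num.sqrt (grad_norm x.1.1 ^+ 2 + fine (Lp_norm 2%:E x.1.2) ^+ 2 +
            grad_norm x.2.1 ^+ 2 + fine (Lp_norm 2%:E x.2.2) ^+ 2).

(* equality of the elements of the energy space represented by x and y *)
Definition Heq (x y : state) : Prop := Hnorm (x - y) = 0.

Definition H_continuous (D : set R) (F : R -> state) : Prop :=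
  (forall t, D t -> Hspace (F t)) /\
  forall t, D t -> forall eps : R, 0 < eps -> exists2 delta : R, 0 < delta &
    forall s, D s -> `|s - t| < delta -> Hnorm (F s - F t) < eps.

(* I is the (Riemann) integral of F over [a, b], as a limit in the energy norm *)
Definition is_Hintegral (F : R -> state) (a b : R) (I : state) : Prop :=
  Hspace I /\
  forall eps : R, 0 < eps -> exists2 delta : R, 0 < delta &
    forall (N : nat) (p xi : nat -> R), p 0%N = a -> p N = b ->
      (forall k, (k < N)%N ->
         p k <= xi k <= p k.+1 /\ p k.+1 - p k < delta) ->
      Hnorm (\sum_(k < N) (p k.+1 - p k) *: F (xi k) - I) < eps.

Definition contraction_semigroup (S : R -> state -> state) : Prop :=
  [/\ (forall t x, 0 <= t -> Hspace x -> Hspace (S t x)),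
      (forall t (c : R) x y, 0 <= t -> Hspace x -> Hspace y ->
         Heq (S t (c *: x + y)) (c *: S t x + S t y)),
      (forall x, Hspace x -> Heq (S 0 x) x) /\
      (forall s t x, 0 <= s -> 0 <= t -> Hspace x ->
         Heq (S (s + t) x) (S s (S t x))),
      (forall x, Hspace x -> Hnorm (S h x - x) @[h --> 0^'+] --> (0 : R)) &
      (forall t x, 0 <= t -> Hspace x -> Hnorm (S t x) <= Hnorm x)].

(* The graph A of an unbounded operator is exactly that of the generator of S. *)
Definition generates (A : state -> state -> Prop) (S : R -> state -> state) :
    Prop :=
  contraction_semigroup S /\
  forall x z, Hspace x -> Hspace z ->
    (A x z <-> Hnorm (h^-1 *: (S h x - x) - z) @[h --> 0^'+] --> (0 : R)).

Definition op_norm (T : state -> state) : \bar R :=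
  ereal_sup [set (Hnorm (T x))%:E | x in [set x | Hspace x /\ Hnorm x <= 1]].

(* x is in the domain of the operator A of the undelayed linear system, and
   A x = z.  That the second components of x are in H^1_0 is expressed by the
   first components of z, which are these functions with their gradients. *)
Definition opA (a1 b : V -> R) (x z : state) : Prop :=
  [/\ H10 x.1.1, H10 x.2.1,
      H10 z.1.1 /\ ae_on z.1.1.1 x.1.2,
      H10 z.2.1 /\ ae_on z.2.1.1 x.2.2 &
      exists w1 w2, [/\ H2_laplacian x.1.1 w1, H2_laplacian x.2.1 w2,
        ae_on z.1.2 (w1 - b * x.2.2 - a1 * x.1.2) &
        ae_on z.2.2 (w2 + b * x.1.2)]].

Definition inject4 (w : V -> R) : state := ((0, 0), (0, w)).

Definition opB (a2 : V -> R) (x : state) : state := inject4 (a2 * x.2.2).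

Definition opF (f1 f2 : R -> R) (x : state) : state :=
  ((0, f1 \o x.1.1.1), (0, f2 \o x.2.1.1)).

Definition hypothesis_N_for (f L : R -> R) : Prop :=
  [/\ continuous f, f 0 = 0,
      (forall r, 0 < r -> forall u v, H10 u -> H10 v ->
         grad_norm u <= r -> grad_norm v <= r ->
         (Lp_norm 2%:E (fun x => f (u.1 x) - f (v.1 x))%R <= (L r * grad_norm (u - v))%:E)%E) &
      exists h : R -> R, [/\ {within `[0, +oo[, continuous h},
        (forall r s, 0 <= r -> r < s -> h r < h s), h 0 = 0 &
        forall u, H10 u ->
          `|\int[mu]_(x in Omega) (f (u.1 x) * u.1 x)|
            <= h (grad_norm u) * grad_norm u ^+ 2]].

Definition hypothesis_N (f1 f2 L : R -> R) : Prop :=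
  [/\ forall r, 0 < r -> 0 < L r, L r @[r --> 0^'+] --> (0 : R),
      hypothesis_N_for f1 L & hypothesis_N_for f2 L].

Definition mild_solution (S : R -> state -> state) (a2 : V -> R) (f1 f2 : R -> R)
    (tau : R) (Psi : R -> state) (U0 : state) (T : R) (U : R -> state) : Prop :=
  let delayed s := if s - tau < 0 then Psi (s - tau) else opB a2 (U (s - tau)) in
  H_continuous `[0, T[ U /\
  forall t, 0 <= t < T -> exists I1 I2,
    [/\ is_Hintegral (fun s => S (t - s) (delayed s)) 0 t I1,
        is_Hintegral (fun s => S (t - s) (opF f1 f2 (U s))) 0 t I2 &
        Heq (U t) (S t U0 - I1 + I2)].

Definition coupling (omega_b : set V) (b : V -> R) : Prop :=
  {within closure Omega, continuous b} /\
  closure omega_b `<=` [set x | Omega x /\ b x != 0].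

Definition G1 (omega omega_b : set V) : Prop :=
  omega_b `<=` omega /\ GCC Omega omega_b.

Definition G2 (omega omega_b : set V) (bstar : R) (b : V -> R) : Prop :=
  [/\ exists2 bplus, 0 < bplus <= bstar & forall x, Omega x -> 0 <= b x <= bplus,
      exists2 bminus, 0 < bminus & {ae mu, forall x, omega_b x -> bminus < b x},
      PMGC Omega omega_b & PMGC Omega omega].

(* bstar is a smallness threshold for the coupling: under G2 relative to bstar,
   the semigroup generated by opA a1 b is exponentially stable. *)
Definition stability_threshold (omega omega_b : set V) (a1 : V -> R) (bstar : R) :
    Prop :=
  0 < bstar /\
  forall b S, coupling omega_b b -> G2 omega omega_b bstar b ->
    generates (opA a1 b) S ->
    exists M alpha : R, [/\ 0 < M, 0 < alpha &
      forall t, 0 <= t -> (op_norm (S t) <= (M * expR (- (alpha * t)))%:E)%E].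

End function_spaces.

(* Main.v *)
(* Set v(s) = e^(alpha s) |U(s)|. Duhamel's formula, the bound
   |S(t)| <= M e^(-alpha t), |B U| <= |a2|_oo |U| and |F(U)| <= L(C_rho) |U| give
     v(t) <= M (|U0| + int_0^tau e^(alpha s) |Psi(s - tau)| ds)
             + M (|a2|_oo e^(alpha tau) + L(C_rho)) int_0^t v(s) ds,
   the delayed term being split at s = tau and shifted by tau on s > tau. Gronwall's
   inequality concludes. *)

(* The energy space is handled through representatives: [Hnorm] is only a seminorm, and the
   linearity of S(t) and the Duhamel formula hold only up to [Heq]. Every estimate is therefore one
   between real numbers, derived from the seminorm inequalities.

   The obstacle is the norm of the two Duhamel integrals. They are limits of Riemann sums, and no
   integrability of the norm of the integrand is established; the delayed integrand may even jump at
   s = tau, where Psi(0) and B U(0) need not agree. The sums converge for every choice of tags, so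
   the tags can be mean value points of an explicit primitive of the upper bound: each term is then
   at most an increment of that primitive, and the increments telescope. A cell with tau in its
   interior takes its tag from one of its two halves.

   The factor e^(alpha tau) comes from moving the weight from s to s - tau; the shifted integral of
   v over [0, t - tau] is then enlarged to [0, t], since v >= 0. Clamping the time variable extends
   the norms continuously to the whole line, which makes the primitives differentiable at end points
   as well. *)
Require Import Defs.
From HB Require Import structures.
From mathcomp Require Import all_boot all_order all_algebra.
From mathcomp Require Import all_classical all_reals all_analysis.
From mathcomp Require Import measurable_realfun ess_sup_inf ring lra.
Set Implicit Arguments.
Unset Strict Implicit.
Unset Printing Implicit Defensive.
Import Order.TTheory GRing.Theory Num.Theory.
Import numFieldNormedType.Exports.
Local Open Scope classical_set_scope.
Local Open Scope ring_scope.

(** * L^p norms *)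

Section Lnorm_complements.
Context d (T : measurableType d) (R : realType).
Variable mu : {measure set T -> \bar R}.

Lemma Lfun_normP (p : \bar R) (f : T -> R) :
  f \in Lfun mu p <->
  measurable_fun setT f /\ ('N[mu]_p[EFin \o f] < +oo)%E.
Proof.
rewrite inE; split=> [/andP[]|[mf Nf]]; first by rewrite !inE.
by apply/andP; split; rewrite inE.
Qed.

Lemma Lnorm_fineK (p : \bar R) (f : T -> R) : f \in Lfun mu p ->
  (fine ('N[mu]_p[EFin \o f])%E)%:E = ('N[mu]_p[EFin \o f])%E.
Proof. by move=> /Lfun_normP[_ ?]; rewrite fineK ?ge0_fin_numE ?Lnorm_ge0. Qed.

Lemma Lfun_LnormZ (p : \bar R) (f : T -> R) (c : R) : (1 <= p)%E ->
  f \in Lfun mu p ->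
  ('N[mu]_p[EFin \o (c *: f)%R] = `|c|%:E * 'N[mu]_p[EFin \o f])%E.
Proof. by move=> p1 fp; have := LnormZ (Lfun_Sub p1 fp) c. Qed.

Lemma ae_le_Lnorm (r : R) (f g : T -> R) : 0 < r ->
  measurable_fun setT f -> measurable_fun setT g ->
  {ae mu, forall x, `|f x| <= `|g x|} ->
  ('N[mu]_r%:E[EFin \o f] <= 'N[mu]_r%:E[EFin \o g])%E.
Proof.
move=> r0 mf mg fg; rewrite unlock.
apply: gt0_ler_poweR; first by rewrite invr_ge0 ltW.
- by rewrite in_itv/= leey integral_ge0// => x _; exact: poweR_ge0.
- by rewrite in_itv/= leey integral_ge0// => x _; exact: poweR_ge0.
apply: ae_ge0_le_integral => //=.
- apply/measurable_EFinP.
  apply: (measurableT_comp (measurable_powR r)).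
  exact: measurableT_comp.
- apply/measurable_EFinP.
  apply: (measurableT_comp (measurable_powR r)).
  exact: measurableT_comp.
- apply: filterS fg => x fgx _.
  by rewrite lee_fin ge0_ler_powR ?nnegrE// ltW.
Qed.

(** The bound is first proved in the extended reals; it makes the norm of f finite, and only then do
    the [fine] values compare. *)
Lemma Lfun_ae_le (r : R) (f g : T -> R) (c : R) : 1 <= r -> 0 <= c ->
  measurable_fun setT f -> g \in Lfun mu r%:E ->
  {ae mu, forall x, `|f x| <= c * `|g x|} ->
  f \in Lfun mu r%:E /\
  (fine 'N[mu]_r%:E[EFin \o f]%E <= c * fine 'N[mu]_r%:E[EFin \o g]%E)%R.
Proof.
move=> r1 c0 mf gr fg; have [mg Ng] := (Lfun_normP _ _).1 gr.
have le1 : ('N[mu]_r%:E[EFin \o f] <= c%:E * 'N[mu]_r%:E[EFin \o g])%E.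
  rewrite -{1}(ger0_norm c0) -Lfun_LnormZ//.
  apply: ae_le_Lnorm => //; first exact: lt_le_trans r1.
    exact: measurable_funM.
  apply: filterS fg => x fgx.
  by rewrite /GRing.scale/= normrM (ger0_norm c0).
have fr : f \in Lfun mu r%:E.
  apply/Lfun_normP; split=> //; apply: le_lt_trans le1 _.
  by rewrite lte_mul_pinfty.
by split=> //; rewrite -lee_fin EFinM !Lnorm_fineK.
Qed.

Lemma fine_Lnorm_ge0 (p : \bar R) (f : T -> \bar R) :
  (0 <= fine 'N[mu]_p[f]%E)%R.
Proof. exact/fine_ge0/Lnorm_ge0. Qed.

Lemma fine_LnormZ (p : \bar R) (f : T -> R) (c : R) : (1 <= p)%E ->
  f \in Lfun mu p ->
  fine 'N[mu]_p[EFin \o (c *: f)%R]%E = `|c| * fine 'N[mu]_p[EFin \o f]%E.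
Proof.
by move=> p1 fp; rewrite Lfun_LnormZ// -(Lnorm_fineK fp) -EFinM.
Qed.

Lemma fine_LnormD (p : \bar R) (f g : T -> R) : (1 <= p)%E ->
  f \in Lfun mu p -> g \in Lfun mu p ->
  (fine 'N[mu]_p[EFin \o (f + g)%R]%E <=
  fine 'N[mu]_p[EFin \o f]%E + fine 'N[mu]_p[EFin \o g]%E)%R.
Proof. by move=> p1 fp gp; have := ler_LnormD (Lfun_Sub p1 fp) (Lfun_Sub p1 gp). Qed.

Lemma Lfun_norm_le (f : T -> R) : f \in Lfun mu +oo%E ->
  {ae mu, forall x, `|f x| <= fine 'N[mu]_(+oo%E)[EFin \o f]%E}.
Proof.
move=> foo; have := Lnorm_fineK foo; set A := fine _; rewrite unlock.
case: ifPn => [mu0 AE|mu0 _].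
  have /= := @ess_sup_ge _ _ _ mu (abse \o (EFin \o f)).
  by rewrite -AE; apply: filterS => x; rewrite /= lee_fin.
(* In this branch the whole space is null and the norm is 0 by convention, so the whole space serves
   as exceptional set. *)
exists setT; split=> //.
by apply/eqP; rewrite eq_le measure_ge0 andbT leNgt.
Qed.

End Lnorm_complements.

(** * The energy seminorm *)

Section euclidean_norm.
Variables (R : realType) (n : nat).
Local Notation V := 'rV[R]_n.+1.
Implicit Types x y : V.

Lemma dotp_ge0 x : 0 <= dotp x x.
Proof. by apply: sumr_ge0 => i _; rewrite -expr2 sqr_ge0. Qed.

Lemma enorm_ge0 x : 0 <= enorm x.
Proof. exact: sqrtr_ge0. Qed.

Lemma sqr_enorm x : enorm x ^+ 2 = dotp x x.
Proof. by rewrite sqr_sqrtr ?dotp_ge0. Qed.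

Lemma dotpC x y : dotp x y = dotp y x.
Proof. by apply: eq_bigr => i _; rewrite mulrC. Qed.

Lemma dotpDl x y z : dotp (x + y) z = dotp x z + dotp y z.
Proof. by rewrite -big_split; apply: eq_bigr => i _; rewrite mxE mulrDl. Qed.

Lemma dotpZl (c : R) x y : dotp (c *: x) y = c * dotp x y.
Proof. by rewrite mulr_sumr; apply: eq_bigr => i _; rewrite mxE mulrA. Qed.

Lemma enormZ (c : R) x : enorm (c *: x) = `|c| * enorm x.
Proof.
rewrite /enorm dotpZl dotpC dotpZl mulrA -expr2 sqrtrM ?sqr_ge0//.
by rewrite sqrtr_sqr.
Qed.

Lemma enorm0_eq0 x : enorm x = 0 -> x = 0.
Proof.
move=> x0; have /eqP : dotp x x = 0 by rewrite -sqr_enorm x0 expr0n.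
rewrite psumr_eq0 => [/allP xi0|i _]; last by rewrite -expr2 sqr_ge0.
apply/rowP => i; rewrite mxE; apply/eqP.
by have := xi0 i (mem_index_enum _); rewrite /= mulf_eq0 orbb.
Qed.

(** Cauchy-Schwarz: expand the square of |y| x - |x| y, which is nonnegative, and divide by 2 |x|
    |y|. The division is why zero vectors are set apart. *)
Lemma dotp_le_enorm x y : dotp x y <= enorm x * enorm y.
Proof.
have [x0|x0] := eqVneq (enorm x) 0.
  by rewrite (enorm0_eq0 x0) -(scale0r 0) dotpZl mul0r mulr_ge0 ?enorm_ge0.
have [y0|y0] := eqVneq (enorm y) 0.
  by rewrite (enorm0_eq0 y0) -(scale0r 0) dotpC dotpZl mul0r mulr_ge0 ?enorm_ge0.
have x_gt0 : 0 < enorm x by rewrite lt0r x0 enorm_ge0.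
have y_gt0 : 0 < enorm y by rewrite lt0r y0 enorm_ge0.
have := dotp_ge0 (enorm y *: x + (- enorm x) *: y).
rewrite dotpDl ![dotp _ (_ + _)]dotpC !dotpDl !dotpZl ![dotp _ (_ *: _)]dotpC.
rewrite !dotpZl (dotpC y x) -!sqr_enorm => h.
have : 0 <= 2 * (enorm x * enorm y) * (enorm x * enorm y - dotp x y).
  by apply: le_trans h _; rewrite le_eqVlt; apply/orP; left; apply/eqP; ring.
by rewrite pmulr_rge0 ?subr_ge0// mulr_gt0// mulr_gt0.
Qed.

Lemma enormD x y : enorm (x + y) <= enorm x + enorm y.
Proof.
rewrite -(@ler_pXn2r _ 2)// ?nnegrE ?addr_ge0 ?enorm_ge0//.
rewrite sqr_enorm dotpDl ![dotp _ (x + y)]dotpC !dotpDl -!sqr_enorm (dotpC y x).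
have := dotp_le_enorm x y; lra.
Qed.

Lemma le_enorm x y : (forall i, `|x 0 i| <= `|y 0 i|) -> enorm x <= enorm y.
Proof.
move=> xy; rewrite ler_wsqrtr//; apply: ler_sum => i _.
by rewrite -!expr2 -(real_normK (num_real (x _ _))) -(real_normK (num_real (y _ _)))
  ler_pXn2r ?nnegrE.
Qed.

End euclidean_norm.

Section energy_norm.
Variables (R : realType) (n : nat) (Omega : set 'rV[R]_n.+1).
Local Notation V := 'rV[R]_n.+1.
Local Notation mu := (leb R n).
Local Notation Lp := (@Lp R n Omega).
Local Notation Lp_norm := (@Lp_norm R n Omega).
Local Notation Hnorm := (@Hnorm R n Omega).
Local Notation Hspace := (@Hspace R n Omega).

Implicit Types (p : \bar R) (u v : V -> R) (w z : V -> V).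

Lemma le1_2E : (1 <= 2%:E :> \bar R)%E.
Proof. by rewrite lee_fin ler1n. Qed.

Lemma restrictrE u x : (u \_ Omega) x = if x \in Omega then u x else 0.
Proof. by []. Qed.

Lemma measurable_Lp p u : Lp p u -> measurable_fun setT (u \_ Omega).
Proof. by case/Lfun_normP. Qed.

Lemma restrictrD u v : (u + v) \_ Omega = u \_ Omega + v \_ Omega.
Proof.
by apply/funext => x; rewrite ?fctE ?restrictrE; case: ifP; rewrite ?addr0.
Qed.

Lemma restrictrZ (c : R) u : (c *: u) \_ Omega = c *: (u \_ Omega).
Proof.
by apply/funext => x; rewrite ?fctE ?restrictrE; case: ifP; rewrite ?scaler0.
Qed.

Lemma LpD p u v : (1 <= p)%E -> Lp p u -> Lp p v -> Lp p (u + v).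
Proof.
move=> p1 up vp; rewrite /Defs.Lp restrictrD.
by have [_] := Lfun_addr_closed mu p1; exact.
Qed.

Lemma LpZ p (c : R) u : (1 <= p)%E -> Lp p u -> Lp p (c *: u).
Proof.
move=> p1 up; rewrite /Defs.Lp restrictrZ.
have [Lfun0 /(_ c _ 0 up Lfun0)] := Lfun_submod_closed mu p1.
by rewrite addr0.
Qed.

Lemma Lp0 p : (1 <= p)%E -> Lp p 0.
Proof.
move=> p1; rewrite -(scale0r 0) /Defs.Lp restrictrZ scale0r.
by have [] := Lfun_addr_closed mu p1.
Qed.

Lemma fine_Lp_normD p u v : (1 <= p)%E -> Lp p u -> Lp p v ->
  fine (Lp_norm p (u + v)) <= fine (Lp_norm p u) + fine (Lp_norm p v).
Proof. by move=> p1 up vp; rewrite /Defs.Lp_norm restrictrD fine_LnormD. Qed.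

Lemma fine_Lp_normZ p (c : R) u : (1 <= p)%E -> Lp p u ->
  fine (Lp_norm p (c *: u)) = `|c| * fine (Lp_norm p u).
Proof. by move=> p1 up; rewrite /Defs.Lp_norm restrictrZ fine_LnormZ. Qed.

Lemma fine_Lp_norm_ge0 p u : 0 <= fine (Lp_norm p u).
Proof. exact: fine_Lnorm_ge0. Qed.

Lemma Lp2_le u v (c : R) : 0 <= c -> measurable_fun setT (u \_ Omega) ->
  Lp 2%:E v -> (forall x, `|u x| <= c * `|v x|) ->
  Lp 2%:E u /\ fine (Lp_norm 2%:E u) <= c * fine (Lp_norm 2%:E v).
Proof.
move=> c0 mu_ vp uv; apply: Lfun_ae_le => //; first by rewrite ler1n.
apply: aeW => x; rewrite !restrictrE; case: ifP => // _.
by rewrite !normr0 mulr0.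
Qed.

Definition Lp2_field (w : V -> V) := forall i, Lp 2%:E (fun x => w x 0 i).

(** The cross terms in the square of the sum are nonnegative. This dominates the length of an L^2
    field by a finite sum of L^2 functions. *)
Lemma enorm_le_sum (x : V) : enorm x <= \sum_i `|x 0 i|.
Proof.
have s0 : 0 <= \sum_i `|x 0 i| by exact: sumr_ge0.
rewrite -(ger0_norm s0) -sqrtr_sqr ler_wsqrtr//.
suff [] : 0 <= \sum_i `|x 0 i| /\ dotp x x <= (\sum_i `|x 0 i|) ^+ 2 by [].
rewrite /dotp; elim/big_ind2: _ => [|a b c e [b0 ab] [e0 ce]|i _].
- by rewrite expr0n.
- split; first exact: addr_ge0.
  by rewrite sqrrD; have := mulr_ge0 b0 e0; lra.
- by rewrite real_normK ?num_real// -expr2.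
Qed.

Lemma Lp2_norm u : Lp 2%:E u -> Lp 2%:E (fun x => `|u x|).
Proof.
move=> up; apply: (@Lp2_le _ u 1 _ _ _ _).1 => //.
  rewrite (_ : _ \_ _ = Num.norm \o (u \_ Omega)).
    exact: measurableT_comp (measurable_Lp up).
  by apply/funext => x; rewrite /= !restrictrE; case: ifP => //; rewrite normr0.
by move=> x; rewrite mul1r normr_id.
Qed.

Lemma Lp2_enorm w : Lp2_field w -> Lp 2%:E (@enorm R n \o w).
Proof.
move=> wp; apply: (@Lp2_le _ (\sum_i (fun x => `|w x 0 i|)) 1 _ _ _ _).1 => //.
(* Extension by 0 outside [Omega] commutes with the square root of the sum of squares, so
   measurability passes from the components to the length. *)
- rewrite (_ : _ \_ _ = Num.sqrt \o
      (fun x => \sum_i ((fun x => w x 0 i) \_ Omega) x ^+ 2)).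
    have msqrt : measurable_fun setT (@Num.sqrt R).
      exact: continuous_measurable_fun (@sqrt_continuous R).
    apply: (measurableT_comp msqrt); apply: measurable_sum => i; apply: measurable_funX.
    exact: measurable_Lp (wp i).
  apply/funext => x /=; rewrite !restrictrE; case: ifP => xO.
    by congr Num.sqrt; apply: eq_bigr => i _; rewrite restrictrE xO expr2.
  by rewrite big1 ?sqrtr0// => i _; rewrite restrictrE xO expr0n.
- elim/big_ind: _ => [|u v|i _]; first exact: Lp0 le1_2E.
    exact: LpD le1_2E.
  exact: Lp2_norm.
- move=> x; rewrite mul1r /= ger0_norm ?enorm_ge0// fct_sumE.
  exact: le_trans (enorm_le_sum _) (ler_norm _).
Qed.

Lemma Lp2_fieldD w z : Lp2_field w -> Lp2_field z -> Lp2_field (w + z).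
Proof.
move=> wp zp i; rewrite (_ : (fun _ => _) =
  (fun x => w x 0 i) + (fun x => z x 0 i)); first exact: LpD le1_2E _ _.
by apply/funext => x; rewrite !fctE mxE.
Qed.

Lemma Lp2_fieldZ (c : R) w : Lp2_field w -> Lp2_field (c *: w).
Proof.
move=> wp i; rewrite (_ : (fun _ => _) = c *: (fun x => w x 0 i)).
  exact: LpZ le1_2E _.
by apply/funext => x; rewrite !fctE mxE.
Qed.

Lemma fine_Lp_norm_enormD w z : Lp2_field w -> Lp2_field z ->
  fine (Lp_norm 2%:E (@enorm R n \o (w + z))) <=
  fine (Lp_norm 2%:E (@enorm R n \o w)) + fine (Lp_norm 2%:E (@enorm R n \o z)).
Proof.
move=> wp zp; apply: le_trans (fine_Lp_normD le1_2E (Lp2_enorm wp) (Lp2_enorm zp)).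
have mwz := measurable_Lp (Lp2_enorm (Lp2_fieldD wp zp)).
have wzp := LpD le1_2E (Lp2_enorm wp) (Lp2_enorm zp).
have [|_] := Lp2_le ler01 mwz wzp; last by rewrite mul1r.
move=> x; rewrite mul1r /= !ger0_norm ?enorm_ge0 ?addr_ge0 ?enorm_ge0//.
exact: enormD.
Qed.

Lemma fine_Lp_norm_enormZ (c : R) w : Lp2_field w ->
  fine (Lp_norm 2%:E (@enorm R n \o (c *: w))) =
  `|c| * fine (Lp_norm 2%:E (@enorm R n \o w)).
Proof.
move=> wp; rewrite (_ : _ \o _ = `|c| *: (@enorm R n \o w)).
  by rewrite (fine_Lp_normZ _ le1_2E (Lp2_enorm wp)) normr_id.
by apply/funext => x; rewrite /= !fctE enormZ.
Qed.

(* Finiteness of the components is all that the seminorm properties of Hnorm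
   require; unlike Hspace it is preserved by sums for free. *)
Definition Hfinite (x : state R n) : Prop :=
  (Lp2_field x.1.1.2 /\ Lp 2%:E x.1.2) /\ (Lp2_field x.2.1.2 /\ Lp 2%:E x.2.2).

Lemma Hspace_finite x : Hspace x -> Hfinite x.
Proof. by case=> [[_ ? _] ? [_ ? _] ?]. Qed.

Lemma HfiniteD x y : Hfinite x -> Hfinite y -> Hfinite (x + y).
Proof.
move=> [[x1 x2] [x3 x4]] [[y1 y2] [y3 y4]]; split; split.
- exact: Lp2_fieldD x1 y1.
- exact: LpD le1_2E x2 y2.
- exact: Lp2_fieldD x3 y3.
- exact: LpD le1_2E x4 y4.
Qed.

Lemma HfiniteZ (c : R) x : Hfinite x -> Hfinite (c *: x).
Proof.
move=> [[x1 x2] [x3 x4]]; split; split.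
- exact: Lp2_fieldZ x1.
- exact: LpZ le1_2E x2.
- exact: Lp2_fieldZ x3.
- exact: LpZ le1_2E x4.
Qed.

Lemma HfiniteN x : Hfinite x -> Hfinite (- x).
Proof. by rewrite -scaleN1r; exact: HfiniteZ. Qed.

Lemma HfiniteB x y : Hfinite x -> Hfinite y -> Hfinite (x - y).
Proof. by move=> xf yf; exact/HfiniteD/HfiniteN. Qed.

(** The energy norm is the Euclidean length of this vector of four seminorms, so its triangle
    inequality follows from those of the components and that of R^4. *)
Let Hcomp (x : state R n) : 'rV[R]_4 :=
  \row_i [:: grad_norm Omega x.1.1; fine (Lp_norm 2%:E x.1.2);
             grad_norm Omega x.2.1; fine (Lp_norm 2%:E x.2.2)]`_i.

Let HnormE x : Hnorm x = enorm (Hcomp x).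
Proof.
rewrite /Defs.Hnorm /enorm /dotp !big_ord_recr big_ord0 /= add0r.
by rewrite !mxE /= -!expr2.
Qed.

Lemma Hnorm_ge0 x : 0 <= Hnorm x.
Proof. exact: sqrtr_ge0. Qed.

Lemma HnormD x y : Hfinite x -> Hfinite y -> Hnorm (x + y) <= Hnorm x + Hnorm y.
Proof.
move=> [[x1 x2] [x3 x4]] [[y1 y2] [y3 y4]]; rewrite !HnormE.
apply: le_trans (enormD _ _); apply: le_enorm => i; rewrite !mxE.
case: i => [[|[|[|[|//]]]] ?] /=;
  rewrite !ger0_norm ?addr_ge0 ?fine_Lp_norm_ge0//.
- exact: fine_Lp_norm_enormD x1 y1.
- exact: fine_Lp_normD le1_2E x2 y2.
- exact: fine_Lp_norm_enormD x3 y3.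
- exact: fine_Lp_normD le1_2E x4 y4.
Qed.

Lemma HnormZ (c : R) x : Hfinite x -> Hnorm (c *: x) = `|c| * Hnorm x.
Proof.
move=> [[x1 x2] [x3 x4]]; rewrite !HnormE.
rewrite -(normr_id c) -enormZ; congr enorm; apply/rowP => i; rewrite !mxE.
case: i => [[|[|[|[|//]]]] ?] /=.
- exact: fine_Lp_norm_enormZ x1.
- exact: fine_Lp_normZ le1_2E x2.
- exact: fine_Lp_norm_enormZ x3.
- exact: fine_Lp_normZ le1_2E x4.
Qed.

Lemma HnormN x : Hfinite x -> Hnorm (- x) = Hnorm x.
Proof. by move=> xf; rewrite -scaleN1r HnormZ// normrN1 mul1r. Qed.

Lemma HnormB x y : Hfinite x -> Hfinite y -> Hnorm (x - y) <= Hnorm x + Hnorm y.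
Proof. by move=> xf yf; rewrite -(HnormN yf); exact/HnormD/HfiniteN. Qed.

Lemma Hnorm_le_distD x y : Hfinite x -> Hfinite y ->
  Hnorm x <= Hnorm (x - y) + Hnorm y.
Proof. by move=> xf yf; rewrite -{1}(subrK y x); exact/HnormD/yf/HfiniteB. Qed.

Lemma Hnorm_dist_le x y : Hfinite x -> Hfinite y ->
  `|Hnorm x - Hnorm y| <= Hnorm (x - y).
Proof.
move=> xf yf; have xy := Hnorm_le_distD xf yf; have yx := Hnorm_le_distD yf xf.
rewrite ler_norml lerBlDr xy andbT lerNl opprB lerBlDr.
by rewrite -(HnormN (HfiniteB xf yf)) opprB.
Qed.

Lemma Hfinite0 : Hfinite 0.
Proof.
have f0 : Lp2_field 0.
  move=> i; rewrite (_ : (fun _ => _) = 0); first exact: Lp0 le1_2E.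
  by apply/funext => x; exact: (mxE _ _ _ i).
by split; split=> //; exact: Lp0 le1_2E.
Qed.

Lemma Hnorm0 : Hnorm 0 = 0.
Proof. by rewrite -(scale0r 0) (HnormZ _ Hfinite0) normr0 mul0r. Qed.

Lemma Hfinite_sum (N : nat) (F : 'I_N -> state R n) :
  (forall k, Hfinite (F k)) -> Hfinite (\sum_k F k).
Proof.
move=> Ff; elim/big_ind: _ => //; first exact: Hfinite0.
exact: HfiniteD.
Qed.

Lemma Hnorm_sum (N : nat) (F : 'I_N -> state R n) : (forall k, Hfinite (F k)) ->
  Hnorm (\sum_k F k) <= \sum_k Hnorm (F k).
Proof.
move=> Ff; suff [] : Hfinite (\sum_k F k) /\
    Hnorm (\sum_k F k) <= \sum_k Hnorm (F k) by [].
elim/big_ind2: _ => [|x a y b [xf xa] [yf yb]|//].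
  by split; [exact: Hfinite0|rewrite Hnorm0].
by split; [exact: HfiniteD|apply: le_trans (HnormD xf yf) (lerD xa yb)].
Qed.

End energy_norm.

(** * Scaling in the energy space and the semigroup bound *)

Section Lnorm_scaling.
Context d (T : measurableType d) (R : realType).
Variable mu : {measure set T -> \bar R}.
Import HBNNSimple.

(* No measurability is assumed: the integral of a nonnegative function is a
   supremum over the simple functions below it, which can be rescaled. *)
Lemma ge0_integralZl_le (k : R) (f : T -> R) : 0 < k -> (forall x, 0 <= f x) ->
  (\int[mu]_x (k * f x)%:E <= k%:E * \int[mu]_x (f x)%:E)%E.
Proof.
move=> k0 f0; have kf0 x : 0 <= k * f x by rewrite mulr_ge0// ltW.
rewrite !ge0_integralTE//.
apply: ge_ereal_sup => _ [h /= hkf <-].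
have k1 : 0 <= k^-1 by rewrite invr_ge0 ltW.
have -> : sintegral mu h = (k%:E * sintegral mu (scale_nnsfun h k1))%E.
  rewrite /= sintegralrM muleA -EFinM divff ?mul1e//.
  by rewrite gt_eqF.
rewrite lee_pmul2l ?lte_fin//.
apply: ereal_sup_ubound; exists (scale_nnsfun h k1) => //= x.
by have := hkf x; rewrite !lee_fin ler_pdivrMl.
Qed.

(** Meant for the approximation errors in [H10], which come without a measurability statement. *)
Lemma le_LnormZ (r c : R) (f : T -> R) : 0 < r -> c != 0 ->
  ('N[mu]_r%:E[EFin \o (c *: f)%R] <= `|c|%:E * 'N[mu]_r%:E[EFin \o f])%E.
Proof.
move=> r0 c0; have nc0 : 0 < `|c| by rewrite normr_gt0.
have cE : (`|c|%:E = (`|c| `^ r)%:E `^ r^-1)%E.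
  by rewrite poweR_EFin -powRrM mulfV ?gt_eqF// powRr1// ltW.
have int_ge0 (g : T -> R) : (0 <= \int[mu]_x (`|g x| `^ r)%:E)%E.
  by apply: integral_ge0 => x _; rewrite lee_fin powR_ge0.
rewrite unlock /= [X in (_ <= X * _)%E]cE -poweRM ?lee_fin ?powR_ge0//.
apply: gt0_ler_poweR; first by rewrite invr_ge0 ltW.
- by rewrite in_itv/= leey int_ge0.
- by rewrite in_itv/= leey mule_ge0 ?lee_fin ?powR_ge0.
under eq_integral do rewrite normrM powRM//.
by apply: ge0_integralZl_le => [|x]; [exact: powR_gt0|exact: powR_ge0].
Qed.

End Lnorm_scaling.

Section energy_space.
Variables (R : realType) (n : nat) (Omega : set 'rV[R]_n.+1).
Local Notation V := 'rV[R]_n.+1.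
Local Notation Lp := (@Lp R n Omega).
Local Notation Lp_norm := (@Lp_norm R n Omega).
Local Notation Hnorm := (@Hnorm R n Omega).
Local Notation Hspace := (@Hspace R n Omega).
Local Notation H10 := (@H10 R n Omega).
Implicit Types (phi : V -> R) (u : H1pair R n).

Lemma partialZ (c : R) i phi x : derivable phi x (delta_mx 0 i) ->
  partial i (c *: phi) x = c * partial i phi x.
Proof. by move=> dphi; rewrite /partial deriveZ. Qed.

Lemma class_CZ k (c : R) phi :
  class_C k setT phi -> class_C k setT (c *: phi).
Proof.
have cZ (f : V -> R) : (forall x, setT x -> {for x, continuous f}) ->
    forall x, setT x -> {for x, continuous (c *: f)}.
  move=> cf x Tx; have -> : c *: f = c \*: f by apply/funext.
  exact: continuousZr (cf x Tx).
elim: k phi => [|k IH] phi [cphi dphi]; split; try exact: cZ.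
  exact: I.
move=> i; have [di Ci] := dphi i; split=> [x Tx|].
  exact: derivableZ (di x Tx).
rewrite (_ : partial i (c *: phi) = c *: partial i phi); first exact: IH.
by apply/funext => x; rewrite partialZ//; exact: di.
Qed.

Lemma gradZ (c : R) phi x : class_C 1 setT phi ->
  grad (c *: phi) x = c *: grad phi x.
Proof.
move=> [_ dphi]; apply/rowP => i; rewrite !mxE partialZ//.
by have [+ _] := dphi i; exact.
Qed.

Lemma test_functionZ (c : R) phi :
  test_function Omega phi -> test_function Omega (c *: phi).
Proof.
move=> [Cphi kphi sphi].
have sub : closure [set x | (c *: phi) x != 0] `<=` closure [set x | phi x != 0].
  apply: closureS => x /=; apply: contra => /eqP phix0.
  by rewrite fctE phix0 scaler0.
split; last exact: subset_trans sphi.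
- by move=> k; exact: class_CZ.
- exact: subclosed_compact (@closed_closure _ _) kphi sub.
Qed.

Lemma class_C0 k : class_C k setT (0 : V -> R).
Proof.
have D0 (v : V) : 'D_v (0 : V -> R) = 0.
  by apply/funext => x; exact: derive_cst.
have c0 x : setT x -> {for x, continuous (0 : V -> R)}.
  by move=> _; exact: cst_continuous.
elim: k => [|k IH]; split; try exact: c0.
  exact: I.
move=> i; split; first by move=> x _; exact: derivable_cst.
by rewrite (_ : partial i 0 = 0) //; exact: D0.
Qed.

Lemma H10_0 : H10 0.
Proof.
have [f0 _] := (@Hfinite0 R n Omega).1; split=> // [|eps eps0].
  exact: Lp0 (le1_2E R).
have N0 : Lp_norm 2%:E 0 = 0%E.
  rewrite /Defs.Lp_norm (_ : _ \o _ = cst 0%E) ?Lnorm0//.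
  by apply/funext => x /=; rewrite restrictrE; case: ifP.
have supp0 : closure [set x : V | (0 : V -> R) x != 0] = set0.
  rewrite (_ : [set _ | _] = set0) ?closure0//.
  by apply/seteqP; split=> // x /=; rewrite eqxx.
exists 0; split.
- split; [exact: class_C0|by rewrite supp0; exact: compact0|by rewrite supp0].
- by rewrite subr0 N0 lte_fin.
- rewrite (_ : (fun x => _) = 0) ?N0 ?lte_fin//.
  apply/funext => x; rewrite (_ : grad 0 x - _ = 0).
    by rewrite -(scale0r 0) enormZ normr0 mul0r.
  by apply/rowP => i; rewrite !mxE /partial derive_cst subr0.
Qed.

(** Scaling allows a state to be normalised before [op_norm] is applied. If phi approximates u
    within eps / |c|, then [c *: phi] approximates [c *: u] within eps. *)
Lemma H10Z (c : R) u : H10 u -> H10 (c *: u).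
Proof.
have [->|c0] := eqVneq c 0; first by rewrite scale0r => _; exact: H10_0.
move=> [u1 u2 du]; split=> [||eps eps0].
- exact: LpZ (le1_2E R) u1.
- exact: Lp2_fieldZ u2.
have nc0 : 0 < `|c| by rewrite normr_gt0.
have /du[phi [tphi phi1 phi2]] : 0 < `|c|^-1 * eps by rewrite mulr_gt0 ?invr_gt0.
have scaled (k : R) (w z : V -> R) : `|k| = `|c| -> z = k *: w ->
    (Lp_norm 2%:E w < (`|c|^-1 * eps)%:E)%E -> (Lp_norm 2%:E z < eps%:E)%E.
  move=> kc ->; rewrite /Defs.Lp_norm restrictrZ => wlt.
  have k0 : k != 0 by rewrite -normr_gt0 kc.
  apply: le_lt_trans (le_LnormZ _ _ _ k0) _ => //.
  by rewrite kc -(mulVKf (lt0r_neq0 nc0) eps) EFinM lte_pmul2l.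
exists (c *: phi); split; first exact: test_functionZ.
- by apply: scaled phi1; [exact: erefl|rewrite scalerBr].
- apply: scaled phi2; first exact: normr_id.
  apply/funext => x; rewrite gradZ; last by have [+ _ _] := tphi; exact.
  by rewrite -scalerBr enormZ.
Qed.

Lemma Hspace0 : Hspace 0.
Proof. by split; try exact: H10_0; exact: Lp0 (le1_2E R). Qed.

Lemma HspaceZ (c : R) x : Hspace x -> Hspace (c *: x).
Proof.
move=> [x1 x2 x3 x4]; split.
- exact: H10Z x1.
- exact: LpZ (le1_2E R) x2.
- exact: H10Z x3.
- exact: LpZ (le1_2E R) x4.
Qed.

Lemma Heq_Hnorm x y : Hfinite Omega x -> Hfinite Omega y -> Heq Omega x y ->
  Hnorm x = Hnorm y.
Proof.
move=> xf yf xy; have := Hnorm_dist_le xf yf.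
by rewrite xy normr_le0 subr_eq0 => /eqP.
Qed.

(* The semigroup is linear only up to Heq, so homogeneity in norm is first
   transferred through S t 0, which contractivity makes null. *)
Lemma semigroup_HnormZ (S : R -> state R n -> state R n) t (c : R) x :
  contraction_semigroup Omega S -> 0 <= t -> Hspace x ->
  `|c| * Hnorm (S t x) <= Hnorm (S t (c *: x)).
Proof.
move=> [Smap Slin _ _ Scontr] t0 xH.
have S0H := Smap t 0 t0 Hspace0.
have SxH := Smap t x t0 xH.
have S0 : Hnorm (S t 0) = 0.
  apply/eqP; rewrite eq_le Hnorm_ge0 andbT -[leRHS](@Hnorm0 R n Omega).
  exact: Scontr t0 Hspace0.
have cS := HfiniteZ c (Hspace_finite SxH).
have SxS0 := HfiniteD cS (Hspace_finite S0H).
have := Slin t c x 0 t0 xH Hspace0; rewrite addr0 => /Heq_Hnorm -> //; last first.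
  exact: Hspace_finite (Smap _ _ t0 (HspaceZ c xH)).
rewrite -(HnormZ c (Hspace_finite SxH)).
have := HnormB SxS0 (Hspace_finite S0H).
by rewrite addrK S0 addr0.
Qed.

(** The supremum is tested on x / |x|. A representative of norm 0 cannot be normalised; there
    contractivity already gives |S(t) x| = 0. *)
Lemma op_norm_le (S : R -> state R n -> state R n) t (K : R) x :
  contraction_semigroup Omega S -> 0 <= t ->
  (op_norm Omega (S t) <= K%:E)%E -> Hspace x -> Hnorm (S t x) <= K * Hnorm x.
Proof.
move=> Ssg t0 SK xH; have [Smap _ _ _ Scontr] := Ssg.
have [x0|x0] := eqVneq (Hnorm x) 0.
  by rewrite x0 mulr0 -x0; exact: Scontr.
have x_gt0 : 0 < Hnorm x by rewrite lt0r x0 Hnorm_ge0.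
have yH := HspaceZ (Hnorm x)^-1 xH.
have : Hnorm (S t ((Hnorm x)^-1 *: x)) <= K.
  rewrite -lee_fin; apply: le_trans SK; apply: ereal_sup_ubound.
  exists ((Hnorm x)^-1 *: x) => //; split=> //.
  by rewrite (HnormZ _ (Hspace_finite xH)) ger0_norm ?invr_ge0 ?Hnorm_ge0// mulVf.
move=> /(le_trans (semigroup_HnormZ (Hnorm x)^-1 Ssg t0 xH)).
by rewrite ger0_norm ?invr_ge0 ?Hnorm_ge0// ler_pdivrMl// mulrC.
Qed.

End energy_space.

(** * Delay and source terms *)

Section perturbations.
Variables (R : realType) (n : nat) (Omega : set 'rV[R]_n.+1).
Local Notation V := 'rV[R]_n.+1.
Local Notation Lp := (@Lp R n Omega).
Local Notation Lp_norm := (@Lp_norm R n Omega).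
Local Notation Hnorm := (@Hnorm R n Omega).
Local Notation Hspace := (@Hspace R n Omega).
Local Notation grad_norm := (@grad_norm R n Omega).

Lemma Hnorm_ge_comp (x : state R n) :
  [/\ grad_norm x.1.1 <= Hnorm x, fine (Lp_norm 2%:E x.1.2) <= Hnorm x,
      grad_norm x.2.1 <= Hnorm x & fine (Lp_norm 2%:E x.2.2) <= Hnorm x].
Proof.
have le_sqrt (a b : R) : 0 <= a -> a ^+ 2 <= b -> a <= Num.sqrt b.
  by move=> a0 ab; rewrite -[leLHS]ger0_norm// -sqrtr_sqr ler_wsqrtr.
rewrite /Defs.Hnorm.
have := sqr_ge0 (grad_norm x.1.1); have := sqr_ge0 (grad_norm x.2.1).
have := sqr_ge0 (fine (Lp_norm 2%:E x.1.2)).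
have := sqr_ge0 (fine (Lp_norm 2%:E x.2.2)).
have := fine_Lp_norm_ge0 Omega 2%:E x.1.2.
have := fine_Lp_norm_ge0 Omega 2%:E x.2.2.
have : 0 <= grad_norm x.1.1 by exact: fine_Lp_norm_ge0.
have : 0 <= grad_norm x.2.1 by exact: fine_Lp_norm_ge0.
move: (grad_norm _) (grad_norm _) (fine _) (fine _) => a b c d *.
by split; apply: le_sqrt => //; lra.
Qed.

Lemma Hnorm_velocity (w z : V -> R) :
  Hnorm ((0, w), (0, z)) =
  Num.sqrt (fine (Lp_norm 2%:E w) ^+ 2 + fine (Lp_norm 2%:E z) ^+ 2).
Proof.
have [g0 _ _ _] := Hnorm_ge_comp 0; rewrite Hnorm0 in g0.
have {}g0 : grad_norm 0 = 0.
  by apply/eqP; rewrite eq_le g0 fine_Lp_norm_ge0.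
by rewrite /Defs.Hnorm /= g0 expr0n add0r addr0.
Qed.

Lemma Lp2_mul_bounded (a y : V -> R) : Lp +oo%E a -> Lp 2%:E y ->
  Lp 2%:E (a * y) /\
  fine (Lp_norm 2%:E (a * y)) <= fine (Lp_norm +oo%E a) * fine (Lp_norm 2%:E y).
Proof.
move=> ap yp.
have ayE : (a * y) \_ Omega = (a \_ Omega) \* (y \_ Omega).
  by apply/funext => x; rewrite /= !restrictrE; case: ifP; rewrite ?mulr0.
have may : measurable_fun setT ((a * y) \_ Omega).
  rewrite ayE; apply: measurable_funM; first exact: measurable_Lp ap.
  exact: measurable_Lp yp.
have ay_le : {ae leb R n, forall x, `|((a * y) \_ Omega) x| <=
    fine (Lp_norm +oo%E a) * `|(y \_ Omega) x|}.
  have := Lfun_norm_le ap; apply: filterS => x ax.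
  by rewrite ayE normrM ler_wpM2r.
exact: Lfun_ae_le (ler1n R 2) (fine_Lp_norm_ge0 _ _ _) may yp ay_le.
Qed.

Lemma opB_le (a2 : V -> R) x : Lp +oo%E a2 -> Hspace x ->
  Hspace (opB a2 x) /\
  Hnorm (opB a2 x) <= fine (Lp_norm +oo%E a2) * Hnorm x.
Proof.
move=> a2p [_ _ _ x4]; have [a2x a2x_le] := Lp2_mul_bounded a2p x4.
split.
  by split; [exact: H10_0|exact: Lp0 (le1_2E R)|exact: H10_0|exact: a2x].
rewrite /opB /inject4 Hnorm_velocity.
have -> : fine (Lp_norm 2%:E 0) = 0.
  by have [_ + _ _] := Hnorm_ge_comp 0; rewrite Hnorm0 => le0;
    apply/eqP; rewrite eq_le le0 fine_Lp_norm_ge0.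
rewrite expr0n add0r sqrtr_sqr ger0_norm ?fine_Lp_norm_ge0//.
apply: le_trans a2x_le _; rewrite ler_wpM2l ?fine_Lp_norm_ge0//.
by have [] := Hnorm_ge_comp x.
Qed.

(** The local Lipschitz bound is used against v = 0, where f vanishes. Being an inequality in the
    extended reals, it also yields that f(u) has finite L^2 norm. *)
Lemma hypothesis_N_le (f L : R -> R) (r : R) (u : H1pair R n) :
  hypothesis_N_for Omega f L -> 0 < r -> H10 Omega u -> grad_norm u <= r ->
  Lp 2%:E (f \o u.1) /\ fine (Lp_norm 2%:E (f \o u.1)) <= L r * grad_norm u.
Proof.
move=> [cf f0 fL _] r0 uH ur; have [u1 _ _] := uH.
have gr0 : grad_norm 0 <= r.
  have [g0 _ _ _] := Hnorm_ge_comp 0; apply: le_trans g0 _.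
  by rewrite Hnorm0 ltW.
have := fL r r0 u 0 uH (@H10_0 R n Omega) ur gr0.
rewrite subr0 (_ : (fun _ => _) = f \o u.1); last first.
  by apply/funext => x; rewrite /= f0 subr0.
move=> fu_le.
have fup : Lp 2%:E (f \o u.1).
  apply/Lfun_normP; split; last exact: le_lt_trans fu_le (ltry _).
  (* Since f(0) = 0, composition with f commutes with extension by 0. *)
  rewrite (_ : _ \_ _ = f \o (u.1 \_ Omega)).
    have mf : measurable_fun setT f by exact: continuous_measurable_fun.
    exact: measurableT_comp mf (measurable_Lp u1).
  by apply/funext => x; rewrite /= !restrictrE; case: ifP.
by split=> //; rewrite -lee_fin Lnorm_fineK.
Qed.

(** Both gradient norms are at most [Hnorm x], so the two Lipschitz bounds apply with the same
    radius r. The velocity terms only enlarge the right-hand side. *)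
Lemma opF_le (f1 f2 L : R -> R) (r : R) x :
  hypothesis_N Omega f1 f2 L -> 0 < r -> Hspace x -> Hnorm x <= r ->
  Hspace (opF f1 f2 x) /\ Hnorm (opF f1 f2 x) <= L r * Hnorm x.
Proof.
move=> [L0 _ Nf1 Nf2] r0 [x1 _ x3 _] xr.
have [g1 _ g3 _] := Hnorm_ge_comp x.
have [f1p f1_le] := hypothesis_N_le Nf1 r0 x1 (le_trans g1 xr).
have [f2p f2_le] := hypothesis_N_le Nf2 r0 x3 (le_trans g3 xr).
split; first by split; [exact: H10_0|exact: f1p|exact: H10_0|exact: f2p].
have Lr0 : 0 <= L r by rewrite ltW// L0.
rewrite /opF Hnorm_velocity -[X in X * _]ger0_norm// -sqrtr_sqr -sqrtrM ?sqr_ge0//.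
rewrite ler_wsqrtr//.
have sq_le (a b : R) : 0 <= a -> a <= b -> a ^+ 2 <= b ^+ 2.
  by move=> a0 ab; rewrite ler_pXn2r ?nnegrE// (le_trans a0).
have := sq_le _ _ (fine_Lp_norm_ge0 _ _ _) f1_le.
have := sq_le _ _ (fine_Lp_norm_ge0 _ _ _) f2_le.
have := mulr_ge0 (sqr_ge0 (L r)) (sqr_ge0 (fine (Lp_norm 2%:E x.1.2))).
have := mulr_ge0 (sqr_ge0 (L r)) (sqr_ge0 (fine (Lp_norm 2%:E x.2.2))).
rewrite !exprMn; move: (L r) (grad_norm _) (grad_norm _).
move: (fine _) (fine _) (fine _) (fine _) => a b c d l e g *.
by rewrite !mulrDr; lra.
Qed.

End perturbations.

(** * Primitives and Gronwall's inequality *)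

Section real_functions.
Variable R : realType.
Implicit Types (f F : R -> R) (a b s t x y : R).

(** The integral from a to x; as its two-sided derivative is f only to the right of a, the base
    point must lie strictly left of the interval of interest. *)
Lemma exists_primitive f a : continuous f ->
  exists F, forall x, a < x -> is_derive x 1 F (f x).
Proof.
move=> cf; exists (fun x => \int[lebesgue_measure]_(t in `[a, x]) f t).
move=> x ax.
have intf : (@lebesgue_measure R).-integrable `[a, x + 1] (EFin \o f).
  apply: continuous_compact_integrable; first exact: segment_compact.
  exact: continuous_subspaceT.
have xx1 : x < x + 1 by rewrite ltrDl.
have [dF <-] := continuous_FTC1_closed xx1 intf ax (cf x).
by rewrite derive1E; exact: derivableP.
Qed.

Lemma MVT_derive F f x y : x < y ->
  (forall s, x <= s <= y -> is_derive s 1 F (f s)) ->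
  exists2 c, x < c < y & F y - F x = f c * (y - x).
Proof.
move=> xy dF.
have [s| |c /[!in_itv]/= cxy FE] := @MVT _ F f _ _ xy.
- by rewrite in_itv/= => /andP[xs sy]; apply: dF; rewrite !ltW.
- apply: derivable_within_continuous => s; rewrite in_itv/= => /dF.
  by move=> /@ex_derive.
- by exists c.
Qed.

(** Of the two tags, keep the one with the smaller value of f: the minimum is at most the weighted
    average. This replaces the mean value theorem across a jump at z. *)
Lemma mean_value_concat f F x z y :
  x <= z -> z <= y ->
  (exists2 c, x <= c <= z & (z - x) * f c <= F z - F x) ->
  (exists2 c, z <= c <= y & (y - z) * f c <= F y - F z) ->
  exists2 c, x <= c <= y & (y - x) * f c <= F y - F x.
Proof.
move=> xz zy [c /andP[xc cz] fc] [d /andP[zd dy] fd].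
have [fcd|/ltW fdc] := leP (f c) (f d).
  exists c; first by rewrite xc (le_trans cz).
  have : (y - z) * f c <= (y - z) * f d by rewrite ler_wpM2l// subr_ge0.
  lra.
exists d; first by rewrite dy andbT (le_trans xz).
have : (z - x) * f d <= (z - x) * f c by rewrite ler_wpM2l// subr_ge0.
lra.
Qed.

Lemma derive_ge0_le F f x y : x <= y ->
  (forall s, x <= s <= y -> is_derive s 1 F (f s)) ->
  (forall s, x <= s <= y -> 0 <= f s) -> F x <= F y.
Proof.
rewrite le_eqVlt => /predU1P[->//|xy] dF f0.
have [c /andP[xc cy] FE] := MVT_derive xy dF.
rewrite -subr_ge0 FE mulr_ge0 ?subr_ge0 ?(ltW xy)//.
by apply: f0; rewrite !ltW.
Qed.

Lemma integral_primitive f F a b : a < b -> continuous f ->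
  (forall s, a <= s <= b -> is_derive s 1 F (f s)) ->
  \int[lebesgue_measure]_(s in `[a, b]) f s = F b - F a.
Proof.
move=> ab cf dF.
have cF s : a <= s <= b -> {for s, continuous F}.
  move=> /dF ?; apply/differentiable_continuous/derivable1_diffP.
  exact: ex_derive.
rewrite /Rintegral (@continuous_FTC2 _ f F)//.
- exact: continuous_subspaceT.
- split.
  + move=> s; rewrite in_itv/= => /andP[sa sb].
    by have := dF s; rewrite !ltW// => /(_ isT) /@ex_derive.
  + by apply: cvg_at_right_filter; apply: cF; rewrite lexx ltW.
  + by apply: cvg_at_left_filter; apply: cF; rewrite lexx ltW.
- move=> s; rewrite in_itv/= => /andP[sa sb]; rewrite derive1E.
  by have := dF s; rewrite !ltW// => /(_ isT) /@derive_val.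
Qed.

(** With V a primitive of u, the quantity (C + K (V(s) - V(0))) e^(-K s) is nonincreasing: its
    derivative is K e^(-K s) times u minus its assumed upper bound. The function [W] below is its
    opposite. *)
Lemma gronwall (u V : R -> R) (C K t : R) : 0 <= t -> 0 <= K ->
  (forall s, 0 <= s <= t -> is_derive s 1 V (u s)) ->
  (forall s, 0 <= s <= t -> u s <= C + K * (V s - V 0)) ->
  u t <= C * expR (K * t).
Proof.
move=> t0 K0 dV uV.
pose W s := (K * (V 0 - V s) - C) * expR (- (K * s)).
have dW s : 0 <= s <= t -> is_derive s 1 W
    (K * (C + K * (V s - V 0) - u s) * expR (- (K * s))).
  move=> /dV dVs; rewrite /W.
  apply: is_derive_eq.
  rewrite /GRing.scale /= !(mulr0, add0r, addr0, mulr1, subr0).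
  ring.
have W0t : W 0 <= W t.
  apply: derive_ge0_le t0 dW _ => s st.
  by rewrite mulr_ge0 ?expR_ge0// mulr_ge0// subr_ge0 uV.
have := uV t; rewrite t0 lexx => /(_ isT) /le_trans; apply.
rewrite -ler_pdivrMr ?expR_gt0// -expRN.
by move: W0t; rewrite /W subrr !mulr0 oppr0 expR0 mulr1; lra.
Qed.

(** The nearest point projection onto [a, b]. Being 1-Lipschitz, it extends a function continuous on
    [a, b] to a continuous function on the line. *)
Definition clamp a b s : R := Num.max a (Num.min b s).

Lemma clamp_itv a b s : a <= b -> a <= clamp a b s <= b.
Proof.
by move=> ab; rewrite /clamp le_max lexx/= ge_max ab ge_min lexx.
Qed.

Lemma clamp_id a b s : a <= s <= b -> clamp a b s = s.
Proof. by move=> /andP[sa sb]; rewrite /clamp min_r// max_r. Qed.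

Lemma clamp_dist a b s t : `|clamp a b s - clamp a b t| <= `|s - t|.
Proof.
have st := ler_norm (s - t); have ts := ler_norm (t - s).
rewrite distrC in ts; rewrite /clamp.
have min_le : `|Num.min b s - Num.min b t| <= `|s - t|.
  by rewrite ler_norml; case: (leP b s) => ?; case: (leP b t) => ?;
    apply/andP; split; lra.
apply: le_trans min_le; move: (Num.min b s) (Num.min b t) => p q.
have pq := ler_norm (p - q); have qp := ler_norm (q - p).
rewrite distrC in qp.
by rewrite ler_norml; case: (leP a p) => ?; case: (leP a q) => ?;
  apply/andP; split; lra.
Qed.

End real_functions.

(** * Integrals of energy-valued functions *)

Section energy_valued_functions.
Variables (R : realType) (n : nat) (Omega : set 'rV[R]_n.+1).
Local Notation Hnorm := (@Hnorm R n Omega).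
Implicit Types F : R -> state R n.

Lemma H_continuous_clamp (D : set R) F (a b : R) : a <= b -> `[a, b] `<=` D ->
  H_continuous Omega D F -> continuous (fun s => Hnorm (F (clamp a b s))).
Proof.
move=> ab abD [FH Fc] s.
have cD r : D (clamp a b r) by apply: abD; rewrite /= in_itv/= clamp_itv.
apply/cvgrPdist_lt => e e0.
have [d d0 dF] := Fc _ (cD s) e e0.
near=> r; rewrite distrC.
have Ff q := Hspace_finite (FH _ (cD q)).
apply: le_lt_trans (Hnorm_dist_le (Ff r) (Ff s)) _.
apply: dF => //; apply: le_lt_trans (clamp_dist _ _ _ _) _.
by near: r; apply/nbhs_ballP; exists d => // r; rewrite /ball/= distrC.
Unshelve. all: by end_near. Qed.

(* Riemann sums are only compared with Phi at tags provided by the hypothesis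
   (mean values, in the applications), which avoids relating the Riemann integral
   of the norm to a primitive. *)
Lemma is_Hintegral_le F (Phi : R -> R) (a b : R) I : a <= b ->
  is_Hintegral Omega F a b I ->
  (forall s, a <= s <= b -> Hfinite Omega (F s)) ->
  (forall x y, a <= x -> x < y -> y <= b ->
     exists2 c, x <= c <= y & (y - x) * Hnorm (F c) <= Phi y - Phi x) ->
  Hnorm I <= Phi b - Phi a.
Proof.
move=> ab [IH Iint] Ff mean; apply/ler_addgt0Pr => e e0.
have [d d0 sums] := Iint e e0.
(* The successor makes N exceed (b - a) / d strictly, so the mesh is below d, and keeps N positive
   when a = b. *)
pose N := (Num.truncn ((b - a) / d)).+1.
have N0 : 0 < N%:R :> R by rewrite ltr0n.
pose h := (b - a) / N%:R.
have h0 : 0 <= h by rewrite divr_ge0 ?subr_ge0.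
have hd : h < d.
  rewrite ltr_pdivrMr// mulrC -ltr_pdivrMr//.
  exact: truncnS_gt.
pose p (k : nat) := a + k%:R * h.
have pN : p N = b by rewrite /p mulrC divfK ?gt_eqF// subrKC.
have p0 : p 0%N = a by rewrite /p mul0r addr0.
have pS k : p k.+1 - p k = h by rewrite /p -natr1; ring.
have ap k : a <= p k by rewrite lerDl mulr_ge0.
have pb k : (k <= N)%N -> p k <= b.
  by move=> kN; rewrite -pN lerD2l ler_wpM2r// ler_nat.
pose tag k c := (k < N)%N -> p k <= c <= p k.+1 /\
  (p k.+1 - p k) * Hnorm (F c) <= Phi (p k.+1) - Phi (p k).
have [xi xiP] : {xi : nat -> R & forall k, tag k (xi k)}.
  apply: choice => k.
  have [kN|nkN] := boolP (k < N)%N; last by exists 0 => kN; case/negP: nkN.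
  (* When a = b all cells are points, outside the scope of [mean], which asks for x < y; any tag
     will do. *)
  have [hz|hpos] := eqVneq h 0.
    have pE : p k.+1 = p k by apply/eqP; rewrite -subr_eq0 pS hz.
    by exists (p k) => _; rewrite pE lexx !subrr mul0r.
  have [|c c1 c2] := mean _ _ (ap k) _ (pb _ kN); last by exists c.
  by rewrite -subr_gt0 pS lt0r hpos.
have xi_ab (k : 'I_N) : a <= xi k <= b.
  have [/andP[pxi xip] _] := xiP k (ltn_ord k).
  by rewrite (le_trans (ap k) pxi) (le_trans xip (pb _ (ltn_ord k))).
have tags k : (k < N)%N -> p k <= xi k <= p k.+1 /\ p k.+1 - p k < d.
  by move=> kN; have [? _] := xiP k kN; rewrite pS.
have := sums N p xi p0 pN tags; set s := \sum_(k < N) _ => sI.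
have Fxi (k : 'I_N) : Hfinite Omega ((p k.+1 - p k) *: F (xi k)).
  by apply: HfiniteZ; exact: Ff.
have sf : Hfinite Omega s by exact: Hfinite_sum.
have If := Hspace_finite IH.
have s_le : Hnorm s <= Phi b - Phi a.
  apply: le_trans (Hnorm_sum Fxi) _.
  rewrite -pN -p0 -(telescope_sumr (Phi \o p) (leq0n N)) big_mkord.
  apply: ler_sum => k _.
  rewrite HnormZ ?ger0_norm; [|by rewrite pS|exact: Ff].
  by have [_] := xiP k (ltn_ord k).
have := Hnorm_le_distD If sf.
rewrite -(HnormN (HfiniteB If sf)) opprB => /le_trans; apply.
by rewrite addrC lerD// ltW.
Qed.

End energy_valued_functions.

(** * Weighted Duhamel estimate and exponential bound *)

Theorem theorem2p1 (R : realType) (n : nat)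
  (Omega omega omega_b : set 'rV[R]_n.+1) (a1 b a2 : 'rV[R]_n.+1 -> R)
  (tau a0 bstar : R) (g : R -> 'rV[R]_n.+1 -> R) (f1 f2 L : R -> R)
  (S : R -> state R n -> state R n) (M alpha T Crho : R)
  (U0 : state R n) (U : R -> state R n) :
  let Psi s := inject4 (a2 * g s) in
  let norm_a2 := fine (Lp_norm Omega +oo%E a2) in
  open Omega -> connected Omega -> Omega !=set0 -> bounded_set Omega ->
  C2_boundary Omega ->
  0 < tau ->
  {within closure Omega, continuous a1} ->
  {ae leb R n, forall x, Omega x -> 0 <= a1 x} ->
  open omega -> omega `<=` Omega ->
  0 < a0 -> {ae leb R n, forall x, omega x -> a0 < a1 x} ->
  open omega_b -> omega_b !=set0 ->
  coupling Omega omega_b b ->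
  Lp Omega +oo%E a2 ->
  H_continuous Omega `[- tau, 0] Psi ->
  Hspace Omega U0 ->
  generates Omega (opA Omega a1 b) S ->
  G1 Omega omega omega_b \/
    (stability_threshold Omega omega omega_b a1 bstar /\
     G2 Omega omega omega_b bstar b) ->
  hypothesis_N Omega f1 f2 L ->
  0 < M -> 0 < alpha ->
  (forall t, 0 <= t ->
     (op_norm Omega (S t) <= (M * expR (- (alpha * t)))%:E)%E) ->
  expR (alpha * tau) * norm_a2 < alpha / M ->
  0 < T ->
  mild_solution Omega S a2 f1 f2 tau Psi U0 T U ->
  0 < Crho ->
  (forall t, 0 <= t < T -> Hnorm Omega (U t) <= Crho) ->
  L Crho < (alpha - M * norm_a2 * expR (alpha * tau)) / M ->
  forall t, 0 <= t < T ->
    Hnorm Omega (U t) <=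
      M * (Hnorm Omega U0 +
           \int[lebesgue_measure]_(s in `[0, tau])
             (expR (alpha * s) * Hnorm Omega (Psi (s - tau)))) *
      expR (- ((alpha - M * norm_a2 * expR (alpha * tau) - M * L Crho) * t)).

Proof.
move=> Psi norm_a2 _ _ _ _ _ tau0 _ _ _ _ _ _ _ _ _ a2p PsiC U0H [Ssg _] _ HN.
move=> M0 alpha0 SM _ T0 [UC mild] Crho0 UCrho _ t /andP[t0 tT].
set A := norm_a2 in SM *; set B := expR (alpha * tau).
have A0 : 0 <= A by exact: fine_Lp_norm_ge0.
have L0 : 0 <= L Crho by have [/(_ _ Crho0)/ltW] := HN.
have B0 : 0 <= B by exact: expR_ge0.
have UH (s : R) : 0 <= s -> s <= t -> Hspace Omega (U s).
  by move=> s0 st; apply: UC.1; rewrite /= in_itv/= s0 (le_lt_trans st).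
have S_le (s : R) x : 0 <= s -> Hspace Omega x ->
    Hnorm Omega (S s x) <= M * expR (- (alpha * s)) * Hnorm Omega x.
  by move=> s0 xH; exact: op_norm_le Ssg s0 (SM s s0) xH.
have S_fin (s : R) x : 0 <= s -> Hspace Omega x -> Hfinite Omega (S s x).
  by move=> s0 xH; apply: Hspace_finite; have [+ _ _ _ _] := Ssg; exact.
have cexp : continuous (fun s => expR (alpha * s)).
  move=> s; apply: continuous_comp; last exact: continuous_expR.
  exact: mulrl_continuous.
pose v s := expR (alpha * s) * Hnorm Omega (U (clamp 0 t s)).
have cv : continuous v.
  have tsub : `[0, t] `<=` `[0, T[.
    by move=> s; rewrite /= !in_itv/= => /andP[-> /le_lt_trans->].
  move=> s; apply: cvgM; first exact: cexp.
  exact: (H_continuous_clamp t0 tsub UC).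
(* On [0, tau] the clamp is inactive and w is the integrand of the history term in the claim. *)
pose w s := expR (alpha * s) * Hnorm Omega (Psi (clamp (- tau) 0 (s - tau))).
have tau_le0 : - tau <= 0 by rewrite oppr_le0 ltW.
have cw : continuous w.
  move=> s; apply: cvgM; first exact: cexp.
  apply: (@continuous_comp _ _ _ (fun s => s - tau)
    (fun r => Hnorm Omega (Psi (clamp (- tau) 0 r)))).
    exact: cvgB cvg_id (cvg_cst _).
  exact: (H_continuous_clamp tau_le0 (@subset_refl _ _) PsiC).
(* The base point -1 gives two-sided derivatives at 0; any negative number would do. *)
have [V dV] := @exists_primitive R v (-1) cv.
have [W dW] := @exists_primitive R w (-1) cw.
have {}dV (s : R) : 0 <= s -> is_derive s 1 V (v s).
  by move=> s0; apply: dV; rewrite (lt_le_trans _ s0)// ltrN10.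
have {}dW (s : R) : 0 <= s -> is_derive s 1 W (w s).
  by move=> s0; apply: dW; rewrite (lt_le_trans _ s0)// ltrN10.
have v0 (s : R) : 0 <= v s by rewrite mulr_ge0 ?expR_ge0 ?Hnorm_ge0.
have w0 (s : R) : 0 <= w s by rewrite mulr_ge0 ?expR_ge0 ?Hnorm_ge0.
have V_le (x y : R) : 0 <= x -> x <= y -> V x <= V y.
  move=> x0 xy; apply: (@derive_ge0_le _ V v) => // s /andP[xs _].
  exact/dV/(le_trans x0).
have W_le (x y : R) : 0 <= x -> x <= y -> W x <= W y.
  move=> x0 xy; apply: (@derive_ge0_le _ W w) => // s /andP[xs _].
  exact/dW/(le_trans x0).
have -> : \int[lebesgue_measure]_(s in `[0, tau])
    (expR (alpha * s) * Hnorm Omega (Psi (s - tau))) = W tau - W 0.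
  rewrite -(integral_primitive tau0 cw (fun s st => dW s (andP st).1)).
  apply: eq_Rintegral => s; rewrite inE/= in_itv/= => /andP[s0 st].
  by rewrite /w clamp_id// lerBrDl subrr s0 lerBlDr add0r.
set C := M * _; set K := M * (A * B + L Crho).
have v_le (r : R) : 0 <= r <= t -> v r <= C + K * (V r - V 0).
  move=> /andP[r0 rt].
  have rT : 0 <= r < T by rewrite r0 (le_lt_trans rt).
  have [I1 [I2 [int1 int2 Ur]]] := mild r rT.
  (* The part of the kernel bound M e^(-alpha (r - s)) that is independent of s; the rest, e^(alpha
     s), is the weight in v and w. *)
  pose E := M * expR (- (alpha * r)).
  have E0 : 0 <= E by rewrite mulr_ge0 ?expR_ge0 ?ltW.
  have expE (s : R) : M * expR (- (alpha * (r - s))) = E * expR (alpha * s).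
    by rewrite /E -mulrA -expRD; congr (_ * expR _); ring.
  have I2_le : Hnorm Omega I2 <= E * (L Crho * V r) - E * (L Crho * V 0).
    apply: (@is_Hintegral_le _ _ _ _ (fun s => E * (L Crho * V s)) _ _ _ r0 int2).
      move=> s /andP[s0 sr]; have st := le_trans sr rt.
      have sT : 0 <= s < T by rewrite s0 (le_lt_trans st).
      apply: S_fin; first by rewrite subr_ge0.
      by have [] := opF_le HN Crho0 (UH s s0 st) (UCrho s sT).
    move=> x y x0 xy yr.
    have [|c /andP[xc cy] VE] := MVT_derive (F := V) (f := v) xy.
      by move=> s /andP[xs _]; apply: dV; exact: le_trans xs.
    exists c; first by rewrite !ltW.
    have c0 : 0 <= c := le_trans x0 (ltW xc).
    have cr : c <= r := le_trans (ltW cy) yr.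
    have ct := le_trans cr rt.
    have cT : 0 <= c < T by rewrite c0 (le_lt_trans ct).
    have [FH F_le] := opF_le HN Crho0 (UH c c0 ct) (UCrho c cT).
    have rc : 0 <= r - c by rewrite subr_ge0.
    have : Hnorm Omega (S (r - c) (opF f1 f2 (U c))) <= E * (L Crho * v c).
      apply: le_trans (S_le _ _ rc FH) _.
      rewrite expE -mulrA ler_wpM2l// /v clamp_id ?c0// mulrCA.
      by rewrite ler_wpM2l ?expR_ge0.
    rewrite -!mulrBr VE.
    have -> : E * (L Crho * (v c * (y - x))) = (y - x) * (E * (L Crho * v c)).
      by ring.
    by move=> le_c; rewrite ler_wpM2l// subr_ge0 ltW.
  set d := fun s => if s - tau < 0 then Psi (s - tau) else opB a2 (U (s - tau)).
  have d_early (s : R) : 0 <= s -> s < tau -> Hspace Omega (d s) /\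
      expR (alpha * s) * Hnorm Omega (d s) = w s.
    move=> s0 stau; have sin : - tau <= s - tau <= 0.
      by rewrite lerBrDl subrr s0 lerBlDr add0r ltW.
    rewrite /d subr_lt0 stau /w clamp_id//; split=> //.
    by apply: PsiC.1; rewrite /= in_itv.
  have d_late (s : R) : tau <= s -> s <= r -> Hspace Omega (d s) /\
      expR (alpha * s) * Hnorm Omega (d s) <= A * B * v (s - tau).
    move=> taus sr; have s0 : 0 <= s - tau by rewrite subr_ge0.
    have st : s - tau <= t.
      by rewrite lerBlDr (le_trans (le_trans sr rt))// lerDl ltW.
    rewrite /d subr_lt0 ltNge taus /=.
    have [BH B_le] := opB_le a2p (UH _ s0 st); split=> //.
    (* Here e^(alpha s) splits as e^(alpha tau) e^(alpha (s - tau)), the origin of the factor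
       [B]. *)
    rewrite /v clamp_id ?s0// -(subrK tau s) mulrDr expRD addrK -/B.
    rewrite [A * B]mulrC -!mulrA mulrCA ler_wpM2l// [A * _]mulrCA.
    by rewrite ler_wpM2l ?expR_ge0.
  have dH (s : R) : 0 <= s -> s <= r -> Hspace Omega (d s).
    move=> s0 sr; have [stau|taus] := ltP s tau.
      by have [] := d_early s s0 stau.
    by have [] := d_late s taus sr.
  (* A primitive of the piecewise bound, with a corner allowed at tau: the minimum freezes the
     history part after tau, the maximum keeps the delayed part constant before it. *)
  pose Phi y := E * (W (Num.min y tau) + A * B * V (Num.max (y - tau) 0)).
  have Sd (s : R) : 0 <= s -> s <= r -> Hnorm Omega (S (r - s) (d s)) <=
      E * (expR (alpha * s) * Hnorm Omega (d s)).
    move=> s0 sr; rewrite mulrA -expE; apply: S_le; first by rewrite subr_ge0.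
    exact: dH.
  have mean_early (x y : R) : 0 <= x -> x < y -> y <= tau -> y <= r ->
      exists2 c, x <= c <= y &
        (y - x) * Hnorm Omega (S (r - c) (d c)) <= Phi y - Phi x.
    move=> x0 xy ytau yr.
    have [|c /andP[xc cy] WE] := MVT_derive (F := W) (f := w) xy.
      by move=> s /andP[xs _]; apply: dW; exact: le_trans xs.
    exists c; first by rewrite !ltW.
    have c0 : 0 <= c := le_trans x0 (ltW xc).
    (* The mean value point lies strictly below y, hence below tau even if y = tau; at tau itself
       [d] already equals B U(0). *)
    have [_ dE] := d_early c c0 (lt_le_trans cy ytau).
    rewrite /Phi !min_l ?(le_trans (ltW xy))// !max_r; last 2 first.
    - by rewrite subr_le0 (le_trans (ltW xy)).
    - by rewrite subr_le0.
    rewrite -mulrBr opprD addrACA subrr addr0 WE mulrA.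
    rewrite [leRHS]mulrC ler_wpM2l ?subr_ge0 ?(ltW xy)//.
    by rewrite -dE Sd// (le_trans (ltW cy)).
  have mean_late (x y : R) : tau <= x -> x < y -> y <= r ->
      exists2 c, x <= c <= y &
        (y - x) * Hnorm Omega (S (r - c) (d c)) <= Phi y - Phi x.
    move=> taux xy yr.
    have xytau : x - tau < y - tau by rewrite ltrD2r.
    (* The mean value point is sought in the cell shifted by -tau; the tag is [c + tau]. *)
    have [|c /andP[xc cy] VE] := MVT_derive (F := V) (f := v) xytau.
      by move=> s /andP[xs _]; apply: dV; apply: le_trans xs; rewrite subr_ge0.
    have xctau : x <= c + tau by rewrite -lerBlDr ltW.
    have cytau : c + tau <= y by rewrite -lerBrDr ltW.
    exists (c + tau); first by rewrite xctau.
    have ctr : c + tau <= r := le_trans cytau yr.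
    have tauc : tau <= c + tau := le_trans taux xctau.
    have [_] := d_late (c + tau) tauc ctr; rewrite addrK => d_le.
    rewrite /Phi !min_r ?(le_trans taux (ltW xy))//.
    rewrite !max_l ?subr_ge0 ?(le_trans taux (ltW xy))//.
    rewrite -mulrBr [- (W _ + _)]opprD addrACA subrr add0r -mulrBr VE.
    rewrite (_ : y - tau - _ = y - x); last by ring.
    rewrite mulrA mulrA [leRHS]mulrC ler_wpM2l ?subr_ge0 ?(ltW xy)//.
    apply: le_trans (Sd _ _ ctr) _; first exact: le_trans (ltW tau0) tauc.
    by rewrite -mulrA ler_wpM2l.
  have I1_le : Hnorm Omega I1 <= Phi r - Phi 0.
    apply: is_Hintegral_le r0 int1 _ _.
      move=> s /andP[s0 sr]; apply: S_fin; first by rewrite subr_ge0.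
      exact: dH.
    move=> x y x0 xy yr; have [ytau|tauy] := leP y tau.
      exact: mean_early.
    have [taux|xtau] := leP tau x; first exact: mean_late.
    apply: (@mean_value_concat R (fun c => Hnorm Omega (S (r - c) (d c)))
      _ _ tau _ (ltW xtau) (ltW tauy)).
      by apply: mean_early => //; exact: le_trans (ltW tauy) yr.
    exact: mean_late.
  have Phi_le : Phi r - Phi 0 <= E * (W tau - W 0 + A * B * (V r - V 0)).
    rewrite /Phi -mulrBr ler_wpM2l// (min_l (ltW tau0)).
    rewrite [Num.max (0 - tau) 0]max_r; last first.
      by rewrite sub0r oppr_le0 ltW.
    (* Monotonicity of both primitives removes the minimum and the maximum: the history part is
       completed up to tau, the delayed part from r - tau up to r. *)
    have Wr : W (Num.min r tau) <= W tau.
      by apply: W_le; rewrite ?le_min ?r0 ?ge_min ?lexx ?orbT// ltW.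
    have Vr : V (Num.max (r - tau) 0) <= V r.
      by apply: V_le; rewrite ?ge_max ?le_max ?lexx ?orbT ?r0 ?andbT// lerBlDr lerDl ltW.
    have : A * B * V (Num.max (r - tau) 0) <= A * B * V r.
      by rewrite ler_wpM2l// mulr_ge0.
    lra.
  have U0f := S_fin r U0 r0 U0H.
  have I1f := Hspace_finite int1.1.
  have I2f := Hspace_finite int2.1.
  rewrite /v clamp_id ?r0// (Heq_Hnorm (Hspace_finite (UH r r0 rt)) _ Ur); last first.
    exact: HfiniteD (HfiniteB U0f I1f) I2f.
  (* Multiplication by the weight e^(alpha r) turns [E] back into M, the constant in [C] and [K]. *)
  have ME : M = expR (alpha * r) * E.
    by rewrite /E mulrCA expRN mulfV ?mulr1// gt_eqF ?expR_gt0.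
  have -> : C + K * (V r - V 0) = expR (alpha * r) *
      (E * (Hnorm Omega U0 + (W tau - W 0)) +
       E * ((A * B + L Crho) * (V r - V 0))).
    by rewrite -mulrDr mulrA -ME /C /K; ring.
  rewrite ler_wpM2l ?expR_ge0//.
  apply: le_trans (HnormD (HfiniteB U0f I1f) I2f) _.
  apply: le_trans (lerD (HnormB U0f I1f) (lexx _)) _.
  apply: le_trans (lerD (lerD (S_le _ _ r0 U0H) (le_trans I1_le Phi_le)) I2_le) _.
  by rewrite -/E le_eqVlt; apply/orP; left; apply/eqP; ring.
have K0 : 0 <= K by rewrite mulr_ge0 ?(ltW M0)// addr_ge0// mulr_ge0.
have := gronwall t0 K0 (fun s st => dV s (andP st).1) v_le.
rewrite /v clamp_id ?t0 ?lexx// => vt.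
(* Removing the weight from v(t) subtracts alpha from the Gronwall rate [K]. *)
have -> : - ((alpha - M * norm_a2 * B - M * L Crho) * t) =
    K * t + - (alpha * t) by rewrite /K /A; ring.
rewrite expRD mulrA expRN ler_pdivlMr ?expR_gt0//.
by rewrite mulrC.
Qed.
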